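(* Let $X$ be a complex analytic manifold of dimension $n$, let $p$ be a positive integer, let $r$ be a non-negative integer, and let $q$ be an integer with $0\le q\le n$. Let $\mathbb{C}\{u,v\}$ be the anti-commutative algebra of polynomials in the variables $u,v$, of degrees $\deg u=p$ and $\deg v=p+1$. If $$P\colon \Lambda^pT^*X\rightsquigarrow \Lambda^qT^*X$$ is a natural holomorphic differential operator of order $\le r$, then there exists a unique homogeneous polynomial $\mathbf{P}(u,v)\in\mathbb{C}\{u,v\}$ of degree $q$ such that $$P(j^r_x\omega)=\mathbf{P}(\omega,\mathrm{d}\omega)_x$$ for every point $x\in X$ and every germ $\omega$ at $x$ of a holomorphic $p$-form.
   Context: $T^*X$ is the holomorphic cotangent bundle of $X$, and $\Lambda^pT^*X$ its $p$-th exterior power. $J^r(\Lambda^pT^*X)\to X$ is the bundle of $r$-jets $j^r_x\omega$ of local holomorphic sections $\omega$ of $\Lambda^pT^*X$ (holomorphic $p$-forms). Lifts: every biholomorphism $\tau\colon U\to V$ between open sets of $X$ lifts to $\Lambda^pT^*X$ by $\tau_*=(\tau^{-1})^*$ (transport of forms along $\tau$), and to the jet bundle by $\tau_*(j^r_x\omega)=j^r_{\tau(x)}(\tau_*\omega)$. A natural holomorphic differential operator $P\colon \Lambda^pT^*X\rightsquigarrow\Lambda^qT^*X$ of order $\le r$ is a holomorphic morphism of fibre bundles $P\colon J^r(\Lambda^pT^*X)\to\Lambda^qT^*X$ over $X$ (not assumed linear on fibres) such that $P\circ\tau_*=\tau_*\circ P$ over $U$ for every biholomorphism $\tau\colon U\to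 V$ between open sets of $X$. Anti-commutative algebra: given variables $u_1,\dots,u_m$ with assigned positive degrees $p_1,\dots,p_m$, $\mathbb{C}\{u_1,\dots,u_m\}$ denotes the associative unital $\mathbb{C}$-algebra of polynomials in these variables subject to the relations $u_iu_j=(-1)^{p_ip_j}u_ju_i$ (including $i=j$, so $u_i^2=0$ if $p_i$ is odd). The degree of a monomial $u_1^{a_1}\cdots u_m^{a_m}$ is $\sum a_ip_i$, and a polynomial is homogeneous of degree $q$ if it is a linear combination of monomials of degree $q$. For a homogeneous polynomial $\mathbf{P}$ of degree $q$ and differential forms $\omega_i$ of degree $p_i$, $\mathbf{P}(\omega_1,\dots,\omega_m)$ is the $q$-form obtained by substituting $\omega_i$ for $u_i$ and replacing products by exterior products. *)

(* Defs.v *)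
From HB Require Import structures.
From mathcomp Require Import all_boot all_order all_algebra.
From mathcomp Require Import all_classical all_reals all_analysis.
From mathcomp Require Import complex.

Set Implicit Arguments.
Unset Strict Implicit.
Unset Printing Implicit Defensive.

Import Order.TTheory GRing.Theory Num.Theory numFieldNormedType.Exports.
Local Open Scope classical_set_scope.
Local Open Scope ring_scope.

(** The complex numbers are [R[i]] for [R : realType]; [differentiable] and
    ['D_v] over the field [R[i]] are complex differentiability and complex
    directional derivatives.  A map is holomorphic on an open set when it is
    complex differentiable at every point of that set.  The library puts a
    topology on an abstract [numFieldType] but not on [R[i]], hence the
    instance below, for the topology of the modulus. *)
HB.instance Definition _ (R : realType) := NormedModule.copy R[i] R[i]^o.

(** * The exterior algebra of the dual of C^n *)

(** [alpha : extalg R n] stands for the sum over [I] of [alpha I] dx_I, where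
    dx_I is the wedge of the dx_i, [i] in [I], in increasing order. *)
Definition extalg (R : realType) (n : nat) : Type :=
  {ffun {set 'I_n} -> R[i]}.

Section Exterior.
Variables (R : realType) (n : nat).
Implicit Types (alpha beta : extalg R n) (I J K : {set 'I_n}).

Definition ext_homog (p : nat) alpha := forall I, #|I| != p -> alpha I = 0.

(** dx_I dx_J = [shuffle_sign I J] dx_(I u J) for disjoint [I] and [J]. *)
Definition shuffle_sign I J : R[i] :=
  (-1) ^+ #|[set ij : 'I_n * 'I_n |
             [&& ij.1 \in I, ij.2 \in J & (ij.2 < ij.1)%N]]|.

Definition wedge alpha beta : extalg R n :=
  [ffun K : {set 'I_n} => \sum_(I : {set 'I_n} | I \subset K)
    shuffle_sign I (K :\: I) * alpha I * beta (K :\: I)].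

Definition ext_scalar (c : R[i]) : extalg R n :=
  [ffun K : {set 'I_n} => if K == finset.set0 then c else 0].

(** L^* dx_i *)
Definition pull_dx (L : 'rV[R[i]]_n -> 'rV[R[i]]_n) (i : 'I_n) : extalg R n :=
  [ffun K : {set 'I_n} => \sum_(j | K == [set j]%SET) L (delta_mx 0 j) 0 i].

(** The algebra morphism L^* induced by a linear map [L]. *)
Definition ext_pull (L : 'rV[R[i]]_n -> 'rV[R[i]]_n) alpha : extalg R n :=
  [ffun K : {set 'I_n} => \sum_(I : {set 'I_n})
    alpha I * (\big[wedge/ext_scalar 1]_(i <- enum I) pull_dx L i) K].

Definition pderiv (i : 'I_n) (f : 'rV[R[i]]_n -> R[i]) :
    'rV[R[i]]_n -> R[i] :=
  fun z => 'D_(delta_mx 0 i) f z.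

(** The mixed partial derivative of multi-index [a]. *)
Definition mpderiv (a : 'I_n -> nat) (f : 'rV[R[i]]_n -> R[i]) :
    'rV[R[i]]_n -> R[i] :=
  foldr (fun i g => iter (a i) (pderiv i) g) f (enum 'I_n).

(** d (sum_J eta_J dx_J) = sum_J sum_k (d eta_J / dx_k) dx_k dx_J *)
Definition ext_d (eta : 'rV[R[i]]_n -> extalg R n) (z : 'rV[R[i]]_n) :
    extalg R n :=
  [ffun K : {set 'I_n} => \sum_(k in K) shuffle_sign [set k]%SET (K :\ k)%SET *
     pderiv k (fun w => eta w (K :\ k)%SET) z].

End Exterior.

(** * Complex manifolds *)

(** [bwd] only matters on the open set [fwd @` dom], the image of the chart. *)
Record chart (R : realType) (n : nat) (X : topologicalType) := Chart {
  dom : set X;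
  fwd : X -> 'rV[R[i]]_n;
  bwd : 'rV[R[i]]_n -> X;
  open_dom : open dom;
  open_codom : open (fwd @` dom);
  fwdK : forall x, dom x -> bwd (fwd x) = x;
  fwd_continuous : forall x, dom x -> {for x, continuous fwd};
  bwd_continuous : forall z, (fwd @` dom) z -> {for z, continuous bwd} }.

Record complex_manifold (R : realType) (n : nat) (X : topologicalType) :=
  ComplexManifold {
  atlas : set (chart R n X);
  atlas_cover : forall x, exists2 c, atlas c & dom c x;
  atlas_holomorphic : forall c d, atlas c -> atlas d ->
    forall x, dom c x -> dom d x ->
    differentiable (fwd d \o bwd c) (fwd c x);
  manifold_hausdorff : hausdorff_space X;
  manifold_countable : @second_countable X }.

Section Manifold.
Variables (R : realType) (n : nat) (X : topologicalType).
Variable M : complex_manifold R n X.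

(** A preferred chart around [x].  It identifies T_x X with C^n, and the
    exterior algebra of T*_x X with [extalg R n]: an element of [extalg R n] is
    a covector at [x] given by its components in [chart_at x], and a
    differential form is a function [X -> extalg R n]. *)
Definition chart_at (x : X) : chart R n X := s2val (cid2 (atlas_cover M x)).

Implicit Types (w : X -> extalg R n) (c : chart R n X).

(** The components in the chart [c] of the covector [alpha] at [x]. *)
Definition covector_in c (x : X) (alpha : extalg R n) : extalg R n :=
  ext_pull ('d (fwd (chart_at x) \o bwd c) (fwd c x)) alpha.

(** The coordinate expression of the form [w] in the chart [c]. *)
Definition form_in c w : 'rV[R[i]]_n -> extalg R n :=
  fun z => covector_in c (bwd c z) (w (bwd c z)).

(** The form on [dom c] whose coordinate expression in [c] is [eta]. *)
Definition form_of c (eta : 'rV[R[i]]_n -> extalg R n) : X -> extalg R n :=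
  fun x => ext_pull ('d (fwd c \o bwd (chart_at x)) (fwd (chart_at x) x))
                    (eta (fwd c x)).

(** [w] is a holomorphic [p]-form on some neighbourhood of [x]. *)
Definition holo_form (p : nat) (x : X) w : Prop :=
  (\forall y \near x, ext_homog p (w y)) /\
  (\forall z \near fwd (chart_at x) x, forall I : {set 'I_n},
     differentiable (fun u => form_in (chart_at x) w u I) z).

(** The exterior derivative of [w] at [x]. *)
Definition form_d w : X -> extalg R n :=
  fun x => ext_d (form_in (chart_at x) w) (fwd (chart_at x) x).

(** * Maps between open sets of the manifold *)

Definition local_expr (f : X -> X) (x : X) : 'rV[R[i]]_n -> 'rV[R[i]]_n :=
  fwd (chart_at (f x)) \o f \o bwd (chart_at x).

Definition holo_on (U : set X) (f : X -> X) : Prop :=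
  forall x, U x -> {for x, continuous f} /\
    differentiable (local_expr f x) (fwd (chart_at x) x).

(** [t] restricts to a biholomorphism of [U] onto [V], with inverse [t']. *)
Definition biholomorphism (U V : set X) (t t' : X -> X) : Prop :=
  [/\ open U /\ open V,
      forall x, U x -> V (t x) /\ t' (t x) = x,
      forall y, V y -> U (t' y) /\ t (t' y) = y,
      holo_on U t & holo_on V t'].

(** The pull-back by [f] of a covector at [f x], a covector at [x]. *)
Definition covector_pull (f : X -> X) (x : X) (alpha : extalg R n) :
    extalg R n :=
  ext_pull ('d (local_expr f x) (fwd (chart_at x) x)) alpha.

Definition form_pull (f : X -> X) w : X -> extalg R n :=
  fun x => covector_pull f x (w (f x)).

(** * Jets and natural operators *)

Definition same_jet (r : nat) (x : X) w w' : Prop :=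
  forall a : {ffun 'I_n -> 'I_r.+1}, (\sum_i a i <= r)%N ->
  forall I : {set 'I_n},
    mpderiv (fun i => a i) (fun z => form_in (chart_at x) w z I)
      (fwd (chart_at x) x) =
    mpderiv (fun i => a i) (fun z => form_in (chart_at x) w' z I)
      (fwd (chart_at x) x).

(** The [r]-jet at [x] of a holomorphic [p]-form [w] defined near [x], as an
    equivalence class. *)
Definition jet (r p : nat) (x : X) w : set (X -> extalg R n) :=
  [set w' | holo_form p x w' /\ same_jet r x w w'].

(** Indices for the fibre coordinates of the bundle of [r]-jets of [p]-forms:
    a multi-index of length at most [r], and a subset with [p] elements. *)
Definition jet_index (r p : nat) : finType :=
  {k : {ffun 'I_n -> 'I_r.+1} * {set 'I_n} |
    (\sum_i k.1 i <= r)%N && (#|k.2| == p)}.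

(** The polynomial form on C^n whose partial derivatives of order at most [r]
    at [y] are the entries of [a]. *)
Definition jet_form (r p : nat) (y : 'rV[R[i]]_n)
    (a : 'rV[R[i]]_#|{: jet_index r p}|) : 'rV[R[i]]_n -> extalg R n :=
  fun z => [ffun I : {set 'I_n} =>
    \sum_(k : jet_index r p | (val k).2 == I)
      a 0 (enum_rank k) *
      \prod_i ((z 0 i - y 0 i) ^+ (val k).1 i / ((val k).1 i)`!%:R)].

(** The coordinate expression of [P] in the chart [c] of [X] and the induced
    chart of the jet bundle.  The latter sends the [r]-jet at [x] of [w] to
    [fwd c x] and the partial derivatives there of the expression of [w] in
    [c]; its inverse sends [(y, a)] to the jet at [bwd c y] of
    [form_of c (jet_form y a)]. *)
Definition operator_in (r p : nat)
    (P : X -> set (X -> extalg R n) -> extalg R n) c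
    (ya : 'rV[R[i]]_n * 'rV[R[i]]_#|{: jet_index r p}|) : extalg R n :=
  let x := bwd c ya.1 in
  covector_in c x (P x (jet r p x (form_of c (jet_form ya.1 ya.2)))).

(** A natural holomorphic differential operator of order at most [r] from
    [p]-forms to [q]-forms.  [P x] sends [r]-jets at [x] to covectors at [x];
    its values on sets of forms which are not such jets are irrelevant.
    In the last clause, t_* is [form_pull t'] on forms. *)
Record natural_operator (r p q : nat)
    (P : X -> set (X -> extalg R n) -> extalg R n) : Prop := NaturalOperator {
  operator_homog : forall x w, holo_form p x w ->
    ext_homog q (P x (jet r p x w));
  operator_holomorphic : forall c, atlas M c ->
    forall x, dom c x -> forall (a : 'rV[R[i]]_#|{: jet_index r p}|)
      (I : {set 'I_n}),
    differentiable (fun ya => operator_in P c ya I) (fwd c x, a);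
  operator_natural : forall U V t t', biholomorphism U V t t' ->
    forall x w, U x -> holo_form p x w ->
    P (t x) (jet r p (t x) (form_pull t' w)) =
    covector_pull t' (t x) (P x (jet r p x w)) }.

End Manifold.

(** * Anti-commutative polynomials *)

(** The anti-commutative algebra on variables u_i of degree [deg i] is given by
    its presentation: terms [acpoly] up to the congruence [aceq], which is
    generated by the axioms of associative unital algebras over [R[i]] and the
    relations u_i u_j = (-1)^(deg i * deg j) u_j u_i. *)
Section Anticommutative.
Variables (R : realType) (m : nat) (deg : 'I_m -> nat).

Inductive acpoly : Type :=
| ACscalar of R[i]
| ACvar of 'I_m
| ACadd of acpoly & acpoly
| ACmul of acpoly & acpoly.

Inductive aceq : acpoly -> acpoly -> Prop :=
| aceq_refl s : aceq s s
| aceq_sym s t : aceq s t -> aceq t s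
| aceq_trans s t u : aceq s t -> aceq t u -> aceq s u
| aceq_add s s' t t' : aceq s s' -> aceq t t' ->
    aceq (ACadd s t) (ACadd s' t')
| aceq_mul s s' t t' : aceq s s' -> aceq t t' ->
    aceq (ACmul s t) (ACmul s' t')
| aceq_addA s t u : aceq (ACadd s (ACadd t u)) (ACadd (ACadd s t) u)
| aceq_addC s t : aceq (ACadd s t) (ACadd t s)
| aceq_add0 s : aceq (ACadd (ACscalar 0) s) s
| aceq_mulA s t u : aceq (ACmul s (ACmul t u)) (ACmul (ACmul s t) u)
| aceq_mul1 s : aceq (ACmul (ACscalar 1) s) s
| aceq_mul0 s : aceq (ACmul (ACscalar 0) s) (ACscalar 0)
| aceq_mulDl s t u : aceq (ACmul (ACadd s t) u) (ACadd (ACmul s u) (ACmul t u))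
| aceq_mulDr s t u : aceq (ACmul s (ACadd t u)) (ACadd (ACmul s t) (ACmul s u))
| aceq_scalarD a b : aceq (ACadd (ACscalar a) (ACscalar b)) (ACscalar (a + b))
| aceq_scalarM a b : aceq (ACmul (ACscalar a) (ACscalar b)) (ACscalar (a * b))
| aceq_scalarC a s : aceq (ACmul (ACscalar a) s) (ACmul s (ACscalar a))
| aceq_anticomm i j : aceq (ACmul (ACvar i) (ACvar j))
    (ACmul (ACscalar ((-1) ^+ (deg i * deg j))) (ACmul (ACvar j) (ACvar i))).

Definition acmonomial (a : {ffun 'I_m -> nat}) : acpoly :=
  \big[ACmul/ACscalar 1]_(i <- enum 'I_m)
     iter (a i) (ACmul (ACvar i)) (ACscalar 1).

(** [s] is a linear combination of monomials of degree [q]. *)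
Definition achomog (q : nat) (s : acpoly) : Prop :=
  exists l : seq (R[i] * {ffun 'I_m -> nat}),
    (forall ca, ca \in l -> (\sum_i ca.2 i * deg i)%N = q) /\
    aceq s (\big[ACadd/ACscalar 0]_(ca <- l)
              ACmul (ACscalar ca.1) (acmonomial ca.2)).

Fixpoint acsubst (n : nat) (w : 'I_m -> extalg R n) (s : acpoly) :
    extalg R n :=
  match s with
  | ACscalar a => ext_scalar n a
  | ACvar i => w i
  | ACadd s1 s2 => acsubst w s1 + acsubst w s2
  | ACmul s1 s2 => wedge (acsubst w s1) (acsubst w s2)
  end.

End Anticommutative.

(** The degrees of the variables u, v. *)
Definition uv_deg (p : nat) : 'I_2 -> nat := tnth [tuple p; p.+1].

(** [s] in C{u,v} satisfies P(j^r_x w) = s(w, dw)_x for all [x] and [w]. *)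
Definition represents (R : realType) (n : nat) (X : topologicalType)
    (M : complex_manifold R n X) (r p : nat)
    (P : X -> set (X -> extalg R n) -> extalg R n) (s : acpoly R 2) : Prop :=
  forall x w, holo_form M p x w ->
    P x (jet M r p x w) = acsubst (tnth [tuple w x; form_d M w x]) s.

(* Main.v *)
(** Read in a chart, the operator at a point becomes a function of the partial
    derivatives of the form at the centre of the chart.  Translations make this
    function independent of the point, and apart from them only linear changes of
    coordinates are needed.  The diagonal torus acts on the derivative of index
    [alpha] of the coefficient of dx_I with weight [alpha + 1_I], and on the
    component of index [K] of the value with weight [1_K].  A complex
    differentiable function with such a weight is multilinear along the partitions
    of [K] into weights, so it is determined by its values on the sums of forms
    z_A dx_I whose blocks A u I partition [K].  By permutation of the coordinates
    such a value depends, up to sign, only on the sizes of the blocks.  It vanishes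
    if some [A] has two elements, since exchanging them preserves the form and
    changes the sign of dx_K, and likewise if two blocks of the same type have odd
    size.  Only one type of partition remains in each degree [q], because at most
    one monomial u^a v^c of degree [q] is nonzero; so a single number determines
    the operator.  As w^a (dw)^c obeys the same rules and is not zero there, every
    natural operator is a multiple of it. *)

(* [P] is not assumed linear on fibres, and multilinearity is never stated as such. What is proved
   is a vanishing criterion, [torus_vanish]. It uses differentiability through one chain rule only:
   if f(t.x) = t f(x) for t != 0, then differentiating at t = 0 expresses f(x) by the differential
   of f at the limit point 0.x, which is linear in the coordinates of weight one. No power series is
   involved.

   Since the criterion speaks of vanishing, the comparison with w^a (dw)^c is a subtraction. The
   constant k is the ratio of the two values on one standard partition; the difference is still
   equivariant and differentiable, and it vanishes on that partition, hence everywhere. If no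
   nonzero monomial has degree q, the same argument with k = 0 shows that [P] is zero. Uniqueness is
   read on the same partition, where the monomial takes the value a! c! up to sign.

   The hypothesis p > 0 gives each jet coordinate a positive weight in some direction, so that the
   torus can kill it or normalise it. *)
From HB Require Import structures.
Require Import Defs.
From mathcomp Require Import all_boot all_order all_algebra.
From mathcomp Require Import all_classical all_reals all_analysis.
From mathcomp Require Import complex ring zify fingroup perm.

Set Implicit Arguments.
Unset Strict Implicit.
Unset Printing Implicit Defensive.

Import Order.TTheory GRing.Theory Num.Theory numFieldNormedType.Exports.
Local Open Scope classical_set_scope.
Local Open Scope ring_scope.

(** * The exterior algebra *)

Section ShuffleSign.
Import mathcomp.boot.fintype mathcomp.boot.finset.
Local Close Scope classical_set_scope.
Variables (R : realType) (n : nat).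
Implicit Types (I J K L : {set 'I_n}).

Definition inversions I J : nat := (\sum_(i in I) \sum_(j in J) (j < i)%N)%N.

Lemma shuffle_signE I J : shuffle_sign R I J = (-1) ^+ inversions I J.
Proof.
rewrite /shuffle_sign /inversions; congr (_ ^+ _).
rewrite pair_big_dep /= -sum1_card big_mkcond [RHS]big_mkcond /=.
(* The set in [shuffle_sign] is a classical one, so membership in it is an [asbool], removed
   here. *)
apply: eq_bigr => -[i j] _; rewrite -[X in if X then _ else _]/(`[< _ >]) asboolb /=.
by case: (i \in I) => /=; case: (j \in J) => /=; case: (j < i)%N.
Qed.

Lemma sum_disjointU (F : 'I_n -> nat) I J : [disjoint I & J] ->
  (\sum_(i in I :|: J) F i = \sum_(i in I) F i + \sum_(j in J) F j)%N.
Proof. by move=> dIJ; rewrite -bigU //; apply: eq_bigl => i; rewrite !inE. Qed.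

Lemma inversionsUl I J K : [disjoint I & J] ->
  inversions (I :|: J) K = (inversions I K + inversions J K)%N.
Proof. by move=> dIJ; rewrite /inversions sum_disjointU. Qed.

Lemma inversionsUr I J K : [disjoint J & K] ->
  inversions I (J :|: K) = (inversions I J + inversions I K)%N.
Proof.
move=> dJK; rewrite /inversions -big_split /=; apply: eq_bigr => i _.
by rewrite sum_disjointU.
Qed.

(** Each pair in the product of [I] and [J] is an inversion for exactly one of the two orders. *)
Lemma inversionsC I J : [disjoint I & J] ->
  (inversions I J + inversions J I = #|I| * #|J|)%N.
Proof.
move=> dIJ; rewrite /inversions [X in (_ + X)%N]exchange_big -big_split /=.
rewrite -sum_nat_const; apply: eq_bigr => i iI.
rewrite -big_split -sum1_card /=; apply: eq_bigr => j jJ.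
case: ltngtP => // /val_inj ij.
by have := disjointFr dIJ iI; rewrite -ij jJ.
Qed.

End ShuffleSign.

Section ExteriorRing.
Import mathcomp.boot.fintype mathcomp.boot.finset.
Local Close Scope classical_set_scope.
Variables (R : realType) (n : nat).
Implicit Types (I J K L : {set 'I_n}).
Local Notation E := (extalg R n).
Implicit Types (alpha beta gamma : E).

(** Both sides are sums over ordered partitions of [K] into three parts. The signs agree because
    [inversions] is additive in each argument: both count the inversions between the three pairs of
    parts. *)
Lemma wedgeA : associative (@wedge R n).
Proof.
move=> a b c; apply/ffunP => K; rewrite !ffunE.
transitivity (\sum_(I : {set 'I_n} | I \subset K)
    \sum_(L : {set 'I_n} | (I \subset L) && (L \subset K))
    shuffle_sign R L (K :\: L) * shuffle_sign R I (L :\: I) *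
      a I * b (L :\: I) * c (K :\: L)); last first.
  rewrite (exchange_big_dep (fun L => L \subset K)) /=; last by move=> ? ? _ /andP[].
  apply: eq_bigr => L LK; rewrite ffunE mulr_sumr mulr_suml.
  rewrite [RHS]big_mkcond [LHS]big_mkcond; apply: eq_bigr => I _.
  case: (boolP (I \subset L)) => [IL|]; last by rewrite !andbF.
  by rewrite (subset_trans IL LK) LK /= !mulrA.
apply: eq_bigr => I IK; rewrite ffunE.
rewrite [RHS](reindex_onto (fun J => I :|: J) (fun L => L :\: I)) /=; last first.
  move=> L /andP[IL _]; apply/setP => k; rewrite !inE.
  by move/subsetP: IL => /(_ k); case: (k \in I) => //= ->.
rewrite mulr_sumr; apply: eq_big => [J|J JK].
  rewrite subsetUl /= subUset IK /=; apply/idP/idP.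
    rewrite subsetD => /andP[-> dJI] /=; apply/eqP/setP => k; rewrite !inE.
    by case: (boolP (k \in I)) => // kI; rewrite (disjointFl dJI kI).
  move=> /andP[JK /eqP eJ]; rewrite subsetD JK /= -eJ.
  by rewrite -setI_eq0; apply/eqP/setP => k; rewrite !inE;
    case: (k \in I); rewrite ?andbF ?andbT.
move: (JK); rewrite subsetD => /andP[JK' dJI].
have dIJ : [disjoint I & J] by rewrite disjoint_sym.
have -> : (I :|: J) :\: I = J.
  apply/setP => k; rewrite !inE; case: (boolP (k \in I)) => // kI.
  by rewrite (disjointFl dJI kI).
have eD : K :\: I :\: J = K :\: (I :|: J) by rewrite setDDl.
have eK : K :\: I = J :|: (K :\: (I :|: J)).
  apply/setP => k; rewrite !inE; case: (boolP (k \in J)) => kJ /=.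
    by rewrite (subsetP JK') // (disjointFr dJI kJ).
  by rewrite orbF.
have dJM : [disjoint J & K :\: (I :|: J)].
  by rewrite -setI_eq0; apply/eqP/setP => k; rewrite !inE; case: (k \in J); rewrite ?orbT ?andbF.
rewrite eD !shuffle_signE {1}eK inversionsUr // inversionsUl // !exprD; ring.
Qed.

Lemma wedge_scalarl c alpha : wedge (ext_scalar n c) alpha = [ffun K => c * alpha K].
Proof.
apply/ffunP => K; rewrite !ffunE (bigD1 set0) ?sub0set //= big1.
  by rewrite shuffle_signE /inversions big_set0 !ffunE eqxx setD0 expr0 mul1r addr0.
by move=> I /andP[_ /negPf I0]; rewrite ffunE I0 mulr0 mul0r.
Qed.

Lemma wedge_scalarr c alpha : wedge alpha (ext_scalar n c) = [ffun K => c * alpha K].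
Proof.
apply/ffunP => K; rewrite !ffunE (bigD1 K) ?subxx //= big1.
  rewrite shuffle_signE /inversions setDv !ffunE eqxx.
  rewrite [X in _ ^+ X](_ : _ = 0%N); first by rewrite expr0 mul1r addr0 mulrC.
  by rewrite big1 // => i _; rewrite big_set0.
move=> I /andP[IK nIK]; rewrite ffunE setD_eq0 ifN ?mulr0 //.
by apply: contraNN nIK => KI; rewrite eqEsubset IK KI.
Qed.

Lemma wedge1 : left_id (ext_scalar n 1) (@wedge R n).
Proof. by move=> a; rewrite wedge_scalarl; apply/ffunP => K; rewrite ffunE mul1r. Qed.

Lemma wedger1 : right_id (ext_scalar n 1) (@wedge R n).
Proof. by move=> a; rewrite wedge_scalarr; apply/ffunP => K; rewrite ffunE mul1r. Qed.

Lemma wedgeDl : left_distributive (@wedge R n) +%R.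
Proof.
move=> a b c; apply/ffunP => K; rewrite !ffunE -big_split /=.
by apply: eq_bigr => I _; rewrite ffunE; ring.
Qed.

Lemma wedgeDr : right_distributive (@wedge R n) +%R.
Proof.
move=> a b c; apply/ffunP => K; rewrite !ffunE -big_split /=.
by apply: eq_bigr => I _; rewrite ffunE; ring.
Qed.

End ExteriorRing.

(** From here on [*] and [^+] on covectors are the exterior product and its powers, and ring lemmas
    apply to them. *)
HB.instance Definition _ (R : realType) (n : nat) :=
  GRing.Zmodule.copy (extalg R n) {ffun {set 'I_n} -> R[i]}.
HB.instance Definition _ (R : realType) (n : nat) :=
  GRing.Zmodule_isPzRing.Build (extalg R n) (@wedgeA R n) (@wedge1 R n)
    (@wedger1 R n) (@wedgeDl R n) (@wedgeDr R n).

Section Exterior.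
Import mathcomp.boot.fintype mathcomp.boot.finset.
Local Close Scope classical_set_scope.
Variables (R : realType) (n : nat).
Implicit Types (I J K L : {set 'I_n}) (c d : R[i]).
Local Notation E := (extalg R n).
Implicit Types (a b : E).

Definition ext_base I : E := [ffun K => (K == I)%:R].
(** The product follows the order of the list, so the list carries an orientation that a set would
    lose. *)
Definition dxs (l : seq 'I_n) : E := \prod_(i <- l) ext_base [set i].

Lemma extalgD a b K : (a + b) K = a K + b K. Proof. exact: ffunE. Qed.
Lemma extalg0 K : (0 : E) K = 0. Proof. exact: ffunE. Qed.
Lemma extalgN a K : (- a) K = - a K. Proof. exact: ffunE. Qed.
Lemma extalg_sum T (r : seq T) (P : pred T) (F : T -> E) K :
  (\sum_(i <- r | P i) F i) K = \sum_(i <- r | P i) F i K.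
Proof. exact: (big_morph (fun a : E => a K) (fun a b => extalgD a b K) (extalg0 K)). Qed.

Lemma extalgM a b K : (a * b) K =
  \sum_(I : {set 'I_n} | I \subset K) shuffle_sign R I (K :\: I) * a I * b (K :\: I).
Proof. exact: ffunE. Qed.

Lemma ext_scalarE c K : ext_scalar n c K = if K == set0 then c else 0.
Proof. exact: ffunE. Qed.

Lemma ext_baseE I K : ext_base I K = (K == I)%:R. Proof. exact: ffunE. Qed.

Lemma ext_scalarM c a K : (ext_scalar n c * a) K = c * a K.
Proof. by rewrite [_ * _](wedge_scalarl c a) ffunE. Qed.

Lemma ext_scalar_comm c a : ext_scalar n c * a = a * ext_scalar n c.
Proof. by rewrite [LHS](wedge_scalarl c a) [RHS](wedge_scalarr c a). Qed.

Lemma ext_scalar1 : ext_scalar n 1 = 1 :> E. Proof. by []. Qed.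
Lemma ext_scalar0 : ext_scalar n 0 = 0 :> E.
Proof. by apply/ffunP => K; rewrite ext_scalarE extalg0 if_same. Qed.
Lemma ext_scalarD c d : ext_scalar n (c + d) = ext_scalar n c + ext_scalar n d.
Proof. by apply/ffunP => K; rewrite extalgD !ext_scalarE; case: eqP; rewrite ?addr0. Qed.
Lemma ext_scalarMM c d : ext_scalar n (c * d) = ext_scalar n c * ext_scalar n d.
Proof. by apply/ffunP => K; rewrite ext_scalarM !ext_scalarE; case: eqP; rewrite ?mulr0. Qed.
Lemma ext_scalarN1 : ext_scalar n (-1) = -1 :> E.
Proof.
by apply/eqP; rewrite -addr_eq0 -ext_scalar1 -ext_scalarD addrC subrr ext_scalar0.
Qed.
Lemma ext_scalarX c k : ext_scalar n (c ^+ k) = ext_scalar n c ^+ k.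
Proof. by elim: k => [//|k IH]; rewrite !exprS ext_scalarMM IH. Qed.
Lemma ext_scalar_sign k : ext_scalar n ((-1) ^+ k) = (-1) ^+ k :> E.
Proof. by rewrite ext_scalarX ext_scalarN1. Qed.

Lemma ext_decomp a : a = \sum_I ext_scalar n (a I) * ext_base I.
Proof.
apply/ffunP => K; rewrite extalg_sum (bigD1 K) //= big1 => [|I nIK].
  by rewrite ext_scalarM ext_baseE eqxx mulr1 addr0.
by rewrite ext_scalarM ext_baseE eq_sym (negPf nIK) mulr0.
Qed.

Lemma homog0 p : ext_homog p (0 : E). Proof. by move=> I _; rewrite extalg0. Qed.
Lemma homogZ p c a : ext_homog p a -> ext_homog p (ext_scalar n c * a).
Proof. by move=> ha I nI; rewrite ext_scalarM ha // mulr0. Qed.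
Lemma homog_sum p T (r : seq T) (P : pred T) (F : T -> E) :
  (forall i, P i -> ext_homog p (F i)) -> ext_homog p (\sum_(i <- r | P i) F i).
Proof. by move=> hF I nI; rewrite extalg_sum big1 // => i Pi; apply: hF. Qed.
Lemma homogM p q a b : ext_homog p a -> ext_homog q b -> ext_homog (p + q) (a * b).
Proof.
move=> ha hb K nK; rewrite extalgM big1 // => I IK.
have [pI|/ha ->] := eqVneq #|I| p; last by rewrite mulr0 mul0r.
rewrite hb ?mulr0 //; apply: contraNneq nK => qKI.
by rewrite -(cardsID I K) (setIidPr IK) pI qKI.
Qed.
Lemma homog_scalar c : ext_homog 0 (ext_scalar n c).
Proof. by move=> I; rewrite ext_scalarE cards_eq0 => /negPf ->. Qed.
Lemma homogX p k a : ext_homog p a -> ext_homog (k * p) (a ^+ k).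
Proof.
move=> ha; elim: k => [|k IH]; first exact: (homog_scalar 1).
by rewrite exprS mulSn; exact: homogM.
Qed.
Lemma homog_base I : ext_homog #|I| (ext_base I).
Proof. by move=> K; rewrite ext_baseE; case: (K =P I) => // ->; rewrite eqxx. Qed.
Lemma homog_prod (l : seq 'I_n) (F : 'I_n -> E) :
  (forall i, ext_homog 1 (F i)) -> ext_homog (size l) (\prod_(i <- l) F i).
Proof.
move=> hF; elim: l => [|i l IH]; first by rewrite big_nil; exact: (homog_scalar 1).
by rewrite big_cons /=; exact: (@homogM 1).
Qed.
Lemma homog_dxs l : ext_homog (size l) (dxs l).
Proof. by apply: homog_prod => i; have := @homog_base [set i]; rewrite cards1. Qed.

(** Exchanging [I] with its complement in [K] matches the two sums, and [inversionsC] compares the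
    two shuffle signs. *)
Lemma graded_comm p q a b : ext_homog p a -> ext_homog q b ->
  a * b = (-1) ^+ (p * q) * (b * a).
Proof.
move=> ha hb; rewrite -ext_scalar_sign; apply/ffunP => K; rewrite ext_scalarM !extalgM.
have DK I : I \subset K -> K :\: (K :\: I) = I.
  move/subsetP => IK; apply/setP => k; rewrite !inE.
  by case: (boolP (k \in I)) => [/IK ->|] //; rewrite andNb.
rewrite (reindex_onto (fun I => K :\: I) (fun I => K :\: I)) //= mulr_sumr.
apply: eq_big => [I|I /andP[_ /eqP eI]].
  rewrite subsetDl /=; apply/eqP/idP => [<-|/DK //]; exact: subsetDl.
rewrite eI; have [qI|/hb ->] := eqVneq #|I| q; last by rewrite !(mulr0, mul0r).
have [pI|/ha ->] := eqVneq #|K :\: I| p; last by rewrite !(mulr0, mul0r).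
rewrite !shuffle_signE -[(p * q)%N]/((p * q)%N).
have dI : [disjoint K :\: I & I] by rewrite -setI_eq0 setIDAC setDIl setDv setI0.
have := @inversionsC n _ _ dI; rewrite pI qI => <-.
by rewrite exprD -!mulrA (mulrCA ((-1) ^+ inversions I _)) signrMK; ring.
Qed.

Lemma oneform_sqr a : ext_homog 1 a -> a * a = 0.
Proof.
move=> ha; have := graded_comm ha ha; rewrite expr1 mulN1r => eN.
apply/ffunP => K; move/ffunP/(_ K): eN; rewrite extalgN extalg0 => /eqP.
by rewrite -addr_eq0 -mulr2n mulrn_eq0 /= => /eqP.
Qed.

(** The elements of [J] below [i] are those that precede it in the enumeration, and their number is
    the exponent of the shuffle sign. This turns that sign into the sign of moving a one-form past a
    list of one-forms. *)
Lemma enum_setU1 (i : 'I_n) J : i \notin J ->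
  exists s1 s2 : seq 'I_n, [/\ size s1 = inversions [set i] J,
    enum J = s1 ++ s2 & enum (i |: J) = s1 ++ i :: s2].
Proof.
move=> iJ; pose r := fun j k : 'I_n => (j < k)%N.
have r_tr : transitive r by move=> x y z; exact: ltn_trans.
have r_irr : irreflexive r by move=> x; exact: ltnn.
have srt K : sorted r (enum K).
  rewrite /enum_mem; apply: sorted_filter => //.
  by rewrite -enumT -(@sorted_map _ _ val ltn) val_enum_ord iota_ltn_sorted.
pose s1 := [seq j <- enum J | r j i]; pose s2 := [seq j <- enum J | r i j].
have r1 : all (r^~ i) s1 by apply/allP => j; rewrite mem_filter => /andP[].
have r2 : all (r i) s2 by apply/allP => j; rewrite mem_filter => /andP[].
have r12 : allrel r s1 s2.
  by apply/allrelP => j k /(allP r1) ji /(allP r2); apply: r_tr ji.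
have [srt1 srt2] : sorted r s1 /\ sorted r s2 by split; apply: sorted_filter.
exists s1, s2; split.
- rewrite size_filter /inversions big_set1 -sum1_count big_enum_cond /=.
  by rewrite big_mkcondr.
(* A strictly increasing list is determined by its members. *)
- apply: (irr_sorted_eq r_tr r_irr) => //; rewrite //; last first.
    move=> j; rewrite mem_cat (mem_filter (r^~ i)) (mem_filter (r i)) !mem_enum.
    rewrite -andb_orl /r -neq_ltn.
    by case: eqP => // /val_inj ->; rewrite (negPf iJ).
  by rewrite sorted_pairwise // pairwise_cat r12 -!sorted_pairwise // srt1 srt2.
- apply: (irr_sorted_eq r_tr r_irr) => //; last first.
    move=> j; rewrite mem_cat in_cons (mem_filter (r^~ i)) (mem_filter (r i)) !mem_enum !inE /r.
    by case: ltngtP => [||/val_inj ->]; rewrite ?eqxx ?orbT //= orbC orbF.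
  rewrite sorted_pairwise // pairwise_cat /= r2 allrel_consr r1 r12 /=.
  by rewrite -!sorted_pairwise // srt1 srt2.
Qed.

Section OneForms.
Variable l : 'I_n -> E.
Hypothesis l1 : forall i, ext_homog 1 (l i).

(** Stated for an arbitrary family of one-forms because it serves twice, for the dx_i and for their
    pull-backs: both obey the same sign rule. *)
Lemma oneform_setU1 (i : 'I_n) J : i \notin J ->
  l i * \prod_(j <- enum J) l j =
  (-1) ^+ inversions [set i] J * \prod_(j <- enum (i |: J)) l j.
Proof.
move=> /enum_setU1[s1 [s2 [<- -> ->]]]; rewrite !big_cat big_cons /= !mulrA.
have hs : ext_homog (size s1) (\prod_(j <- s1) l j) by exact: homog_prod.
rewrite (graded_comm (l1 i) hs) mul1n.
by rewrite !mulrA.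
Qed.

Lemma oneform_mem (i : 'I_n) J : i \in J -> l i * \prod_(j <- enum J) l j = 0.
Proof.
move=> iJ; have /enum_setU1[s1 [s2 [_ _]]] : i \notin J :\ i by rewrite setD11.
rewrite setD1K // => ->; rewrite big_cat big_cons /= !mulrA.
have hs : ext_homog (size s1) (\prod_(j <- s1) l j) by exact: homog_prod.
rewrite (graded_comm (l1 i) hs).
by rewrite -!mulrA (mulrA (l i)) oneform_sqr // mul0r !mulr0.
Qed.

End OneForms.

Lemma homog_base1 (i : 'I_n) : ext_homog 1 (ext_base [set i]).
Proof. by have := @homog_base [set i]; rewrite cards1. Qed.

(** Induction on the cardinal, removing the least index, which creates no inversion with the
    others. *)
Lemma ext_base_enum I : ext_base I = dxs (enum I).
Proof.
have [k] := ubnP #|I|; elim: k I => // k IH I leI.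
case: (set_0Vmem I) => [->|].
  by rewrite enum_set0 /dxs big_nil; apply/ffunP => K; rewrite ext_baseE ext_scalarE; case: eqP.
move=> [i0 i0I]; pose i := [arg min_(j < i0 in I) (j : nat)].
have [iI imin] : i \in I /\ forall j, j \in I -> (i <= j)%N.
  by rewrite /i; case: arg_minnP.
have inv0 : inversions [set i] (I :\ i) = 0%N.
  rewrite /inversions big_set1 big1 // => j; rewrite !inE => /andP[_ /imin].
  by rewrite leqNgt => /negPf ->.
have niI : i \notin I :\ i by rewrite setD11.
rewrite -[in RHS](setD1K iI) /dxs.
have := oneform_setU1 homog_base1 niI.
rewrite inv0 expr0 mul1r => <-.
have := IH (I :\ i); rewrite /dxs => <-; last first.
  by rewrite -ltnS (leq_trans _ leI) // [in X in (_ < X)%N](cardsD1 i I) iI.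
apply/ffunP => K; rewrite extalgM ext_baseE.
have [->|nKI] := eqVneq K I.
  rewrite (bigD1 [set i]) ?sub1set //= big1 => [|J /andP[_ nJ]].
    by rewrite shuffle_signE inv0 !ext_baseE !eqxx !mulr1 addr0.
  by rewrite ext_baseE (negPf nJ) mulr0 mul0r.
rewrite big1 // => J JK; rewrite !ext_baseE.
case: eqP => [eJ|]; last by rewrite mulr0 mul0r.
case: eqP => [eK|]; last by rewrite mulr0.
case/eqP: nKI; rewrite -(setD1K iI) -eK -eJ.
by apply/setP => j; rewrite !inE; move/subsetP/(_ j): JK; case: (j \in J) => //= ->.
Qed.

Lemma ext_base_mul (i : 'I_n) J : i \notin J ->
  ext_base [set i] * ext_base J = (-1) ^+ inversions [set i] J * ext_base (i |: J).
Proof.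
move=> iJ; rewrite !(ext_base_enum J, ext_base_enum (i |: J)).
exact: (oneform_setU1 homog_base1).
Qed.

Lemma ext_base_mul0 (i : 'I_n) J : i \in J -> ext_base [set i] * ext_base J = 0.
Proof. by move=> iJ; rewrite (ext_base_enum J); exact: (oneform_mem homog_base1). Qed.

Section Pull.
Variable L : 'rV[R[i]]_n -> 'rV[R[i]]_n.

Lemma homog_pull_dx i : ext_homog 1 (pull_dx L i).
Proof.
move=> K nK; rewrite ffunE big1 // => j /eqP eK.
by rewrite eK cards1 in nK.
Qed.

Lemma ext_pullE a : ext_pull L a = \sum_I ext_scalar n (a I) * \prod_(i <- enum I) pull_dx L i.
Proof.
apply/ffunP => K; rewrite ffunE extalg_sum.
by apply: eq_bigr => I _; rewrite ext_scalarM.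
Qed.

Lemma ext_pullD a b : ext_pull L (a + b) = ext_pull L a + ext_pull L b.
Proof.
rewrite !ext_pullE -big_split; apply: eq_bigr => I _ /=.
by rewrite extalgD ext_scalarD mulrDl.
Qed.

Lemma ext_pullZ c a : ext_pull L (ext_scalar n c * a) = ext_scalar n c * ext_pull L a.
Proof.
rewrite !ext_pullE mulr_sumr; apply: eq_bigr => I _ /=.
by rewrite ext_scalarM ext_scalarMM mulrA.
Qed.

Lemma ext_pull0 : ext_pull L 0 = 0.
Proof. by rewrite -{1}(mul0r 0) -ext_scalar0 ext_pullZ ext_scalar0 mul0r. Qed.

Lemma ext_pull_sum T (r : seq T) (P : pred T) (F : T -> E) :
  ext_pull L (\sum_(i <- r | P i) F i) = \sum_(i <- r | P i) ext_pull L (F i).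
Proof. exact: (big_morph _ ext_pullD ext_pull0). Qed.

Lemma ext_pull_base I : ext_pull L (ext_base I) = \prod_(i <- enum I) pull_dx L i.
Proof.
rewrite ext_pullE (bigD1 I) //= [X in _ + X]big1 => [|J nJ].
  by rewrite ext_baseE eqxx ext_scalar1 mul1r addr0.
by rewrite ext_baseE (negPf nJ) ext_scalar0 mul0r.
Qed.

Lemma ext_pull1 : ext_pull L 1 = 1.
Proof.
have e1 : (1 : E) = ext_base set0 by rewrite ext_base_enum enum_set0 /dxs big_nil.
by rewrite {1}e1 ext_pull_base enum_set0 big_nil.
Qed.

Lemma ext_pull_dx i : ext_pull L (ext_base [set i]) = pull_dx L i.
Proof. by rewrite ext_pull_base enum_set1 big_seq1. Qed.

(** Inserting a one-form into a product follows the same rule before and after pull-back.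
    Multiplicativity in general follows by peeling one dx_i at a time. *)
Lemma ext_pull_dxM i b : ext_pull L (ext_base [set i] * b) = pull_dx L i * ext_pull L b.
Proof.
rewrite (ext_decomp b) !(mulr_sumr, ext_pull_sum); apply: eq_bigr => J _.
rewrite mulrA -ext_scalar_comm -mulrA !ext_pullZ mulrA -(ext_scalar_comm _ (pull_dx L i)) -mulrA.
congr (_ * _); have [iJ|iJ] := boolP (i \in J).
  by rewrite ext_base_mul0 // ext_pull0 ext_pull_base (oneform_mem homog_pull_dx).
rewrite ext_base_mul // -ext_scalar_sign ext_pullZ !ext_pull_base ext_scalar_sign.
by rewrite (oneform_setU1 homog_pull_dx).
Qed.

Lemma ext_pullM a b : ext_pull L (a * b) = ext_pull L a * ext_pull L b.
Proof.
rewrite (ext_decomp a) mulr_suml !ext_pull_sum mulr_suml.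
apply: eq_bigr => I _; rewrite -mulrA !ext_pullZ -mulrA; congr (_ * _).
rewrite ext_base_enum /dxs; elim: (enum I) => [|i l IH].
  by rewrite big_nil mul1r ext_pull1 mul1r.
by rewrite big_cons -mulrA !ext_pull_dxM IH mulrA.
Qed.

Lemma ext_pullX a k : ext_pull L (a ^+ k) = ext_pull L a ^+ k.
Proof. by elim: k => [|k IH]; rewrite ?expr0 ?ext_pull1 // !exprS ext_pullM IH. Qed.

Lemma ext_pull_dxs l : ext_pull L (dxs l) = \prod_(i <- l) pull_dx L i.
Proof.
rewrite /dxs; elim: l => [|i l IH]; first by rewrite !big_nil ext_pull1.
by rewrite !big_cons ext_pull_dxM IH.
Qed.

Lemma homog_pull p a : ext_homog p a -> ext_homog p (ext_pull L a).
Proof.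
move=> ha; rewrite ext_pullE; apply: homog_sum => I _.
have [<-|/ha ->] := eqVneq #|I| p; last by rewrite ext_scalar0 mul0r; exact: homog0.
by apply: homogZ; rewrite cardE; apply: homog_prod => i; exact: homog_pull_dx.
Qed.

End Pull.

Lemma pull_dxE (L : 'rV[R[i]]_n -> 'rV[R[i]]_n) (i : 'I_n) :
  pull_dx L i = \sum_j ext_scalar n (L (delta_mx 0 j) 0 i) * ext_base [set j].
Proof.
apply/ffunP => K; rewrite ffunE extalg_sum big_mkcond; apply: eq_bigr => j _.
by rewrite ext_scalarM ext_baseE; case: (K == _); rewrite ?mulr1 ?mulr0.
Qed.

(** Both sides are algebra morphisms, so only dx_i matters, and there the claim is the formula for a
    product of matrices. *)
Lemma ext_pull_comp (L L' : {linear 'rV[R[i]]_n -> 'rV[R[i]]_n}) a :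
  ext_pull (L \o L') a = ext_pull L' (ext_pull L a).
Proof.
rewrite (ext_decomp a) !ext_pull_sum; apply: eq_bigr => I _; rewrite !ext_pullZ.
congr (_ * _); rewrite ext_base_enum !ext_pull_dxs (big_morph _ (ext_pullM L') (ext_pull1 L')).
apply: eq_bigr => i _; rewrite !pull_dxE ext_pull_sum.
under [RHS]eq_bigr => k _ do rewrite ext_pullZ ext_pull_dx pull_dxE mulr_sumr.
rewrite exchange_big; apply: eq_bigr => j _ /=.
under eq_bigr => k _ do rewrite mulrA -ext_scalarMM.
rewrite -mulr_suml -(big_morph (ext_scalar n) ext_scalarD ext_scalar0); congr (ext_scalar n _ * _).
rewrite [X in L X](row_sum_delta (L' (delta_mx 0 j))) linear_sum summxE.
by apply: eq_bigr => k _; rewrite linearZ mxE mulrC.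
Qed.

Lemma ext_pull_id a : ext_pull id a = a.
Proof.
rewrite [RHS]ext_decomp ext_pullE; apply: eq_bigr => I _; congr (_ * _).
rewrite ext_base_enum /dxs; apply: eq_bigr => i _; rewrite pull_dxE (bigD1 i) //= big1.
  by rewrite mxE !eqxx ext_scalar1 mul1r addr0.
by move=> j nj; rewrite mxE eqxx eq_sym (negPf nj) ext_scalar0 mul0r.
Qed.
End Exterior.

(** * Functions with a torus weight *)

Section Torus.
Variables (R : realType) (N : nat).
Local Notation C := R[i].
Implicit Types (x y : 'rV[C]_N) (w : 'I_N -> nat) (f : 'rV[C]_N -> C) (t : C).

(** At t = 0, where 0 ^+ 0 = 1, this keeps the coordinates of weight zero and kills all the
    others. *)
Definition torus_act w t x : 'rV[C]_N := \row_s (t ^+ w s * x 0 s).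

Lemma differentiable_pow (V : normedModType C) (g : V -> C) k v :
  differentiable g v -> differentiable (fun u => g u ^+ k) v.
Proof.
move=> dg; elim: k => [|k IH].
  by under eq_fun do rewrite expr0; exact: differentiable_cst.
by under eq_fun do rewrite exprS; exact: differentiableM.
Qed.

Lemma torus_act_sum w x : torus_act w ^~ x =
  \sum_s (fun t => t ^+ w s *: (x 0 s *: delta_mx 0 s : 'rV[C]_N)).
Proof.
apply/funext => t; rewrite fct_sumE [LHS]row_sum_delta.
by apply: eq_bigr => s _; rewrite mxE scalerA.
Qed.

Lemma differentiable_torus_act w x t : differentiable (torus_act w ^~ x) t.
Proof.
rewrite torus_act_sum; apply: differentiable_sum => s.
apply: differentiableZl; exact: differentiable_pow.
Qed.

Lemma derive_pow0 k : 'D_1 (fun t : C => t ^+ k) 0 = (k == 1)%:R.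
Proof.
rewrite exp_derive; case: k => [|[|k]]; rewrite ?scale0r //= ?expr0 ?scaler1 //.
by rewrite expr0n /= scaler0.
Qed.

Lemma diff_torus_act w x :
  'd (torus_act w ^~ x) 0 1 = \row_s ((w s == 1%N)%:R * x 0 s).
Proof.
have dpow k : differentiable (fun t : C => t ^+ k) 0 by exact: differentiable_pow.
rewrite -deriveE; last exact: differentiable_torus_act.
rewrite torus_act_sum derive_sum => [|s]; last first.
  by apply: diff_derivable; exact: differentiableZl.
rewrite [RHS]row_sum_delta; apply: eq_bigr => s _.
rewrite deriveE; last exact: differentiableZl.
by rewrite diffZl // -deriveE // derive_pow0 mxE scalerA.
Qed.

(** Equivariance is available for t != 0 only, since the torus element must be invertible; the
    arguments below need the limit t = 0. *)
Lemma punctured_eq (g h : C -> C) : {for 0, continuous g} -> {for 0, continuous h} ->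
  (forall t, t != 0 -> g t = h t) -> g 0 = h 0.
Proof.
move=> /continuous_withinNx cg /continuous_withinNx ch gh.
have gh0 : g t @[t --> 0^'] --> h 0.
  apply: cvg_trans ch; apply: near_eq_cvg.
  near=> t; apply/esym/gh; near: t; exact: nbhs_dnbhs_neq.
by rewrite -(cvg_lim (@norm_hausdorff _ _) cg) -(cvg_lim (@norm_hausdorff _ _) gh0).
Unshelve. all: by end_near. Qed.

Lemma torus_weight0 w f x : (forall y, differentiable f y) ->
  (forall t, t != 0 -> f (torus_act w t x) = f x) -> f x = f (torus_act w 0 x).
Proof.
move=> df fw; apply: (@punctured_eq (cst (f x)) (fun t => f (torus_act w t x))).
- exact: cst_continuous.
- apply: differentiable_continuous.
  apply: (@differentiable_comp _ _ _ _ (torus_act w ^~ x) f) => //.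
  exact: differentiable_torus_act.
- by move=> t /fw ->.
Qed.

(** The function t |-> f(t.x) equals t f(x), so f(x) is its derivative at 0, computed by the chain
    rule. The right-hand side is linear in the coordinates of weight one once those of weight zero
    are fixed. *)
Lemma torus_weight1 w f x : (forall y, differentiable f y) ->
  (forall t, t != 0 -> f (torus_act w t x) = t * f x) ->
  f x = 'd f (torus_act w 0 x) (\row_s ((w s == 1%N)%:R * x 0 s)).
Proof.
move=> df fw; pose g := f \o (torus_act w ^~ x).
have dg : differentiable g 0.
  by apply: differentiable_comp => //; exact: differentiable_torus_act.
have gE : g = fun t => t * f x.
  apply/funext => t; have [->|/fw //] := eqVneq t 0.
  apply: (@punctured_eq g (fun t => t * f x)) => //.
  - exact: differentiable_continuous.
  - by apply: differentiable_continuous; exact: differentiableM.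
transitivity ('d g 0 1); last first.
  rewrite diff_comp //=; last exact: differentiable_torus_act.
  by rewrite diff_torus_act.
rewrite -deriveE // gE deriveMr //.
by rewrite derive_id [RHS]mulr1.
Qed.

(** The induction measure: a coordinate counts 0 if it is zero, 1 if it is one, and 2 otherwise.
    Killing a coordinate or normalising it to one makes the measure drop. *)
Definition torus_complexity x : nat :=
  (\sum_s ((x 0 s != 0)%R + ((x 0 s != 0) && (x 0 s != 1))%R))%N.

Lemma torus_complexity_lt x y s0 :
  (forall s, (y 0 s == x 0 s) || (y 0 s == 0) || (y 0 s == 1) && (x 0 s != 0)) ->
  x 0 s0 != 0 -> (y 0 s0 = 0 \/ y 0 s0 = 1 /\ x 0 s0 != 1) ->
  (torus_complexity y < torus_complexity x)%N.
Proof.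
move=> yx xs ys; rewrite /torus_complexity (bigD1 s0) //= [X in (_ < X)%N](bigD1 s0) //=.
rewrite -addSn leq_add //; last first.
  apply: leq_sum => s _; case/orP: (yx s) => [/orP[] /eqP ->|/andP[/eqP -> ->]] //.
    by rewrite eqxx.
  by rewrite oner_eq0 eqxx.
case: ys => [->|[-> ->]]; rewrite xs ?eqxx ?oner_eq0 //.
Qed.

(** Strong induction on the complexity: unless [x] is the 0/1 vector of an exact partition of [K],
    the weights express [f x] through values of [f] at simpler vectors. *)
Lemma torus_vanish n f (wt : 'I_N -> 'I_n -> nat) (K : {set 'I_n}) :
  (forall x, differentiable f x) ->
  (forall s, exists k, (0 < wt s k)%N) ->
  (forall k t x, t != 0 -> f (torus_act (wt ^~ k) t x) = t ^+ (k \in K) * f x) ->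
  (forall T : {set 'I_N}, (forall k, \sum_(s in T) wt s k = (k \in K))%N ->
     f (\row_s (s \in T)%:R) = 0) ->
  forall x, f x = 0.
Proof.
move=> df wt_gt0 fw f1 x.
have [m] := ubnP (torus_complexity x); elim: m x => // m IH x ltm.
have f_lt y : (torus_complexity y < torus_complexity x)%N -> f y = 0.
  by move=> ltyx; apply: IH; apply: leq_trans ltyx _.
have torus0 k y s : torus_act (wt ^~ k) 0 y 0 s = (wt s k == 0)%N%:R * y 0 s.
  by rewrite mxE expr0n.
(* If a nonzero coordinate has weight in a direction outside [K], then [f] is invariant in that
   direction, and the limit t = 0 kills the coordinate. *)
have [[k [s [kK s_neq0 wts]]]|outK] :=
    pselect (exists k s, [/\ k \notin K, x 0 s != 0 & (0 < wt s k)%N]).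
  rewrite (torus_weight0 df (w := wt ^~ k)) => [|t t0]; last first.
    by rewrite fw // (negPf kK) mul1r.
  apply: f_lt; apply: (torus_complexity_lt _ s_neq0).
    move=> s'; rewrite torus0; case: (wt s' k == 0%N); rewrite ?mul1r ?mul0r eqxx ?orbT //.
  by left; rewrite torus0 gtn_eqF // mul0r.
(* By linearity, [f x] splits over the coordinates of weight one; each summand is again a value of
   [f], at the vector that keeps only one of the coordinates moved by [k]. *)
have line k : k \in K -> f x = \sum_(s | (wt s k == 1)%N && (x 0 s != 0))
    f (torus_act (wt ^~ k) 0 x + x 0 s *: delta_mx 0 s).
  move=> kK; rewrite (torus_weight1 df (w := wt ^~ k)) => [|t t0]; last first.
    by rewrite fw // kK.
  rewrite [X in 'd _ _ X]row_sum_delta linear_sum /= [RHS]big_mkcond.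
  apply: eq_bigr => s _; rewrite mxE.
  case: eqP => [wts|_]; rewrite ?mul0r ?scale0r ?linear0 // mul1r.
  case: (altP (x 0 s =P 0)) => [->|xs]; first by rewrite scale0r linear0.
  set y := _ + _; rewrite [RHS](torus_weight1 df (w := wt ^~ k)) => [|t t0]; last first.
    by rewrite fw // kK.
  (* The coordinate added in [y] has weight one and disappears in the limit, so both differentials
     are taken at the same point. *)
  have -> : torus_act (wt ^~ k) 0 y = torus_act (wt ^~ k) 0 x.
    apply/rowP => s'; rewrite !torus0 !mxE eqxx /= expr0n.
    by case: (s' =P s) => [->|_]; rewrite ?wts ?mul0r // mulr0 addr0 mulrA -natrM mulnb andbb.
  congr ('d f _ _); apply/rowP => s'; rewrite !mxE eqxx /= expr0n.
  by case: (s' =P s) => [->|_]; rewrite ?wts /= ?mulr0 ?addr0 ?mul0r ?add0r ?mulr1 ?mul1r //;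
    case: (wt s' k) => [|[|j]]; rewrite /= ?(mul0r, mulr0).
(* If two nonzero coordinates compete for the same direction of [K], every summand of [line] loses
   one of them. *)
have [[k [s1 [s2 [kK x1 x2 s12 /andP[w1 w2]]]]]|disj] := pselect (exists k s1 s2,
    [/\ k \in K, x 0 s1 != 0, x 0 s2 != 0, s1 != s2 & (0 < wt s1 k)%N && (0 < wt s2 k)%N]).
  rewrite (line k kK) big1 // => s /andP[/eqP wts xs]; apply: f_lt.
  have [s' [xs' ns ws]] : exists s', [/\ x 0 s' != 0, s' != s & (0 < wt s' k)%N].
    have [e|] := eqVneq s1 s; last by exists s1.
    by exists s2; split; rewrite // -e eq_sym.
  apply: (torus_complexity_lt _ xs').
    move=> j; rewrite mxE torus0 !mxE eqxx /=.
    case: (j =P s) => [->|_]; first by rewrite wts mul0r add0r mulr1 eqxx.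
    by rewrite mulr0 addr0; case: (wt j k == 0%N); rewrite ?mul1r ?mul0r eqxx ?orbT.
  by left; rewrite mxE torus0 !mxE eqxx (negPf ns) mulr0 addr0 gtn_eqF // mul0r.
pose T := [set s | x 0 s != 0]%SET.
(* If no nonzero coordinate has weight one along some direction of [K], the sum in [line] is
   empty. *)
have [[k kK nT]|sumT] := pselect (exists2 k, k \in K & forall s, s \in T -> wt s k <> 1%N).
  rewrite (line k kK) big1 // => s /andP[/eqP wts xs].
  by case: (nT s); rewrite ?finset.inE.
have part k : (\sum_(s in T) wt s k = (k \in K))%N.
  have [kK|kK] := boolP (k \in K); last first.
    rewrite big1 // => s; rewrite finset.inE => xs; apply/eqP; rewrite -leqn0 leqNgt.
    by apply/negP => wts; case: outK; exists k, s.
  have [s sT wts] : exists2 s, s \in T & wt s k = 1%N.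
    apply: contrapT => H; apply: sumT; exists k => // s sT wts; apply: H; by exists s.
  rewrite (bigD1 s) //= wts big1 // => s' /andP[s'T ns].
  move: sT s'T; rewrite !finset.inE => sT s'T.
  apply/eqP; rewrite -leqn0 leqNgt; apply/negP => ws'; apply: disj.
  by exists k, s, s'; split; rewrite // 1?eq_sym // wts.
(* Now the support of [x] is an exact partition: either [x] is its indicator, or some coordinate is
   neither 0 nor 1. *)
have [[s xs1 xs]|all01] := pselect (exists2 s, x 0 s != 1 & x 0 s != 0); last first.
  rewrite -[RHS](f1 T part); congr f; apply/rowP => s; rewrite mxE finset.inE.
  have [->//|xs /=] := eqVneq (x 0 s) 0; apply/eqP/negPn/negP => xs1.
  by apply: all01; exists s.
(* Only [s] has weight along [k] in the support, so acting by the inverse of [x 0 s] sets this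
   coordinate to one, fixes the others, and multiplies [f] by a nonzero factor. *)
have [k wts] := wt_gt0 s.
have kK : k \in K by apply/negPn/negP => nK; apply: outK; exists k, s.
have sT : s \in T by rewrite finset.inE.
have wt1 : wt s k = 1%N.
  have := part k; rewrite kK (bigD1 s) //=; case: (wt s k) wts => [|[]] //.
have := fw k (x 0 s)^-1 x; rewrite kK expr1 invr_eq0 => /(_ xs).
rewrite f_lt; first by move/esym/eqP; rewrite mulf_eq0 invr_eq0 (negPf xs) => /eqP.
have sE : torus_act (wt ^~ k) (x 0 s)^-1 x 0 s = 1 by rewrite mxE wt1 expr1 mulVf.
apply: (torus_complexity_lt _ xs); last by right; rewrite sE.
move=> j; have [->|nj] := eqVneq j s; first by rewrite sE eqxx xs !orbT.
have [xj|xj] := eqVneq (x 0 j) 0; first by rewrite mxE xj mulr0 eqxx.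
suff -> : torus_act (wt ^~ k) (x 0 s)^-1 x 0 j = x 0 j by rewrite eqxx.
rewrite mxE; suff -> : wt j k = 0%N by rewrite mul1r.
apply/eqP; rewrite -leqn0 leqNgt; apply/negP => wj; apply: disj.
by exists k, s, j; split; rewrite // 1?eq_sym // wts wj.
Qed.
End Torus.

(** * Charts and their transition maps *)

Section Germs.
Variables (K : numFieldType) (V W : normedModType K).
Implicit Types (f g : V -> W) (z : V).

(** The expansion of [g] with the differential of [f] identifies ['d g z] through [diff_unique]
    before [g] is known to be differentiable. *)
Lemma near_diff_expansion f g z : (\forall u \near z, f u = g u) ->
  differentiable f z -> g \o shift z = cst (g z) + 'd f z +o_ 0 id.
Proof.
move=> fg df; have fgz : f z = g z by exact: (nbhs_singleton fg).
have /eqaddoP fo := diff_locally df.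
apply/eqaddoP => e e0; have := fo e e0; rewrite near_simpl => fe.
have fg0 : \forall h \near (0 : V), f (h + z) = g (h + z).
  by move: fg; rewrite (near_shift 0 z) subr0.
near=> h.
have -> : (g \o shift z - (cst (g z) + 'd f z)) h =
          (f \o shift z - (cst (f z) + 'd f z)) h.
  rewrite /= -[LHS]/(g (h + z) - (g z + 'd f z h)).
  rewrite -[RHS]/(f (h + z) - (f z + 'd f z h)) -fgz.
  by congr (_ - _); apply/esym; near: h.
by near: h.
Unshelve. all: by end_near. Qed.

Lemma near_diff f g z : (\forall u \near z, f u = g u) -> differentiable f z ->
  'd g z = 'd f z :> (V -> W).
Proof.
move=> fg df; apply: diff_unique; first exact: diff_continuous.
exact: near_diff_expansion.
Qed.

Lemma near_differentiable f g z : (\forall u \near z, f u = g u) ->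
  differentiable f z -> differentiable g z.
Proof.
move=> fg df; apply/diff_locallyP; rewrite (near_diff fg df).
by split; [exact: diff_continuous|exact: near_diff_expansion].
Qed.

End Germs.

Section Transitions.
Variables (R : realType) (n : nat) (X : topologicalType).
Variable M : complex_manifold R n X.
Implicit Types (c d e : chart R n X) (x : X).

Lemma atlas_chart_at x : atlas M (chart_at M x).
Proof. exact: (s2valP (cid2 (atlas_cover M x))). Qed.

Lemma dom_chart_at x : dom (chart_at M x) x.
Proof. exact: (s2valP' (cid2 (atlas_cover M x))). Qed.

Definition transition c d : 'rV[R[i]]_n -> 'rV[R[i]]_n := fwd d \o bwd c.

Lemma codom_fwd c x : dom c x -> (fwd c @` dom c) (fwd c x).
Proof. by exists x. Qed.

Lemma codomK c z : (fwd c @` dom c) z -> dom c (bwd c z) /\ fwd c (bwd c z) = z.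
Proof. by case=> x dx <-; rewrite fwdK. Qed.

Lemma near_codom c x : dom c x -> \forall z \near fwd c x, (fwd c @` dom c) z.
Proof.
by move=> dx; apply: open_nbhs_nbhs; split; [exact: open_codom|exact: codom_fwd].
Qed.

Lemma near_bwd c x (A : set X) : dom c x -> (\forall x' \near x, A x') ->
  \forall z \near fwd c x, A (bwd c z).
Proof.
move=> dx Ax; have cb : bwd c z @[z --> fwd c x] --> bwd c (fwd c x).
  exact: (bwd_continuous (codom_fwd dx)).
by rewrite fwdK // in cb; exact: cb.
Qed.

Lemma near_dom c x : dom c x -> \forall x' \near x, dom c x'.
Proof. by move=> dx; apply: open_nbhs_nbhs; split => //; exact: open_dom. Qed.

Lemma transition_fwd c d x : dom c x -> transition c d (fwd c x) = fwd d x.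
Proof. by move=> dx; rewrite /transition /= fwdK. Qed.

Lemma differentiable_transition c d x : atlas M c -> atlas M d ->
  dom c x -> dom d x -> differentiable (transition c d) (fwd c x).
Proof. by move=> ac ad; apply: (@atlas_holomorphic _ _ _ M). Qed.

Lemma near_transition_comp c d e x : dom c x -> dom d x ->
  \forall z \near fwd c x, (transition d e \o transition c d) z = transition c e z.
Proof.
move=> cx dx; near=> z; rewrite /transition /= fwdK //.
by near: z; apply: (near_bwd cx); exact: near_dom.
Unshelve. all: by end_near. Qed.

Lemma near_transition_id c x : dom c x ->
  \forall z \near fwd c x, id z = transition c c z.
Proof.
move=> cx; near=> z; have /codomK[_ <-] : (fwd c @` dom c) z; last first.
  by rewrite /transition /= fwdK //; apply: (codomK _).1; near: z; exact: near_codom.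
by near: z; exact: near_codom.
Unshelve. all: by end_near. Qed.

Lemma diff_transition_id c x : dom c x ->
  'd (transition c c) (fwd c x) = id :> ('rV[R[i]]_n -> 'rV[R[i]]_n).
Proof.
move=> cx; rewrite (near_diff (near_transition_id cx)) //; exact: diff_val.
Qed.

Lemma diff_transition_comp c d e x : atlas M c -> atlas M d -> atlas M e ->
  dom c x -> dom d x -> dom e x ->
  'd (transition c e) (fwd c x) =
  'd (transition d e) (fwd d x) \o 'd (transition c d) (fwd c x)
    :> ('rV[R[i]]_n -> 'rV[R[i]]_n).
Proof.
move=> ac ad ae cx dx ex.
have dcd := differentiable_transition ac ad cx dx.
have dde : differentiable (transition d e) (transition c d (fwd c x)).
  rewrite (transition_fwd d cx); exact: (differentiable_transition ad ae dx ex).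
have dcomp := differentiable_comp dcd dde.
have nt := near_transition_comp e cx dx.
have nd := near_diff nt dcomp.
apply: (etrans nd); apply: (etrans (diff_comp dcd dde)).
by rewrite (transition_fwd d cx).
Qed.

(** At each point, the differentials of the two transitions between [c] and the preferred chart are
    inverse to each other. *)
Lemma form_in_of c eta z : atlas M c -> (fwd c @` dom c) z ->
  form_in M c (form_of M c eta) z = eta z.
Proof.
move=> ac [x cx <-]; rewrite /form_in /covector_in /form_of fwdK //.
rewrite -ext_pull_comp -(diff_transition_comp _ (atlas_chart_at x)) //; try exact: dom_chart_at.
by rewrite diff_transition_id // ext_pull_id.
Qed.

Lemma covector_in_chart_at x alpha : covector_in M (chart_at M x) x alpha = alpha.
Proof.
rewrite /covector_in diff_transition_id; last exact: dom_chart_at.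
exact: ext_pull_id.
Qed.

End Transitions.

(** * Local biholomorphisms of X read as maps of C^n between two charts *)

Section ChartMaps.
Variables (R : realType) (n : nat) (X : topologicalType).
Variable M : complex_manifold R n X.
Implicit Types (c : chart R n X) (x : X).
Local Notation V := 'rV[R[i]]_n.

Lemma differentiable_mulmxr (A : 'M[R[i]]_n) (z : V) : differentiable (mulmxr A : V -> V) z.
Proof.
have -> : (mulmxr A : V -> V) = \sum_i (fun u : V => u 0 i *: row i A).
  by apply/funext => u; rewrite fct_sumE /= mulmx_sum_row.
apply: differentiable_sum => i; apply: differentiableZl.
exact: differentiable_coord.
Qed.

Lemma diff_mulmxr (A : 'M[R[i]]_n) (z : V) : 'd (mulmxr A : V -> V) z = mulmxr A :> (V -> V).
Proof.
apply: diff_lin => u; apply: differentiable_continuous.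
exact: differentiable_mulmxr.
Qed.

Definition affine_map (y y' : V) (A : 'M[R[i]]_n) : V -> V :=
  fun z => y + (z - y') *m A.

Lemma affine_mapE y y' A : affine_map y y' A = (mulmxr A : V -> V) + cst (y - y' *m A).
Proof.
apply/funext => z; rewrite /affine_map /= mulmxBl addrCA.
by rewrite -[RHS]/(z *m A + (y - y' *m A)).
Qed.

Lemma differentiable_affine y y' A z : differentiable (affine_map y y' A) z.
Proof.
rewrite affine_mapE; apply: differentiableD; last exact: differentiable_cst.
exact: differentiable_mulmxr.
Qed.

Lemma diff_affine y y' A z : 'd (affine_map y y' A) z = mulmxr A :> (V -> V).
Proof.
rewrite affine_mapE; apply: (etrans (diffD _ _)).
- exact: differentiable_mulmxr.
- exact: differentiable_cst.
- have e1 := @diff_mulmxr A z; have e2 := @diff_cst _ _ _ (y - y' *m A) z.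
  by apply: (etrans (congr2 (fun f g : V -> V => f \+ g) e1 e2)); exact: addr0.
Qed.

Lemma affine_mapK y y' A : A \in unitmx ->
  cancel (affine_map y y' A) (affine_map y' y (invmx A)).
Proof. by move=> uA z; rewrite /affine_map (addrC y) addrK mulmxK // addrC subrK. Qed.

(** Meaningful on [chart_map_dom] only. The values elsewhere are arbitrary, which is harmless since
    [biholomorphism] looks only inside its open sets. *)
Definition chart_map c c' (f : V -> V) : X -> X := bwd c' \o f \o fwd c.

Definition chart_map_dom c c' (f : V -> V) : set X :=
  [set x | dom c x /\ (fwd c' @` dom c') (f (fwd c x))].

Section ChartMap.
Variables (c c' : chart R n X) (f g : V -> V).
Hypotheses (ac : atlas M c) (ac' : atlas M c').
Hypothesis df : forall z, differentiable f z.
Hypothesis fK : cancel f g.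

Lemma chart_map_continuous x : chart_map_dom c c' f x ->
  {for x, continuous (chart_map c c' f)}.
Proof.
move=> [cx fx]; apply: (@continuous_comp _ _ _ (f \o fwd c) (bwd c')); last exact: bwd_continuous.
apply: continuous_comp; first exact: fwd_continuous.
exact: differentiable_continuous.
Qed.

Lemma open_chart_map_dom : open (chart_map_dom c c' f).
Proof.
rewrite openE => x [cx fx].
have ffwd : {for x, continuous (f \o fwd c)}.
  apply: continuous_comp; first exact: fwd_continuous.
  exact: differentiable_continuous.
have nf : \forall z \near f (fwd c x), (fwd c' @` dom c') z.
  by apply: open_nbhs_nbhs; split => //; exact: open_codom.
near=> x'; split; first by near: x'; exact: near_dom.
by near: x'; exact: (ffwd _ nf).
Unshelve. all: by end_near. Qed.

Lemma chart_map_mem x : chart_map_dom c c' f x ->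
  chart_map_dom c' c g (chart_map c c' f x) /\
  chart_map c' c g (chart_map c c' f x) = x.
Proof.
move=> [cx fx]; have [cx' fx'] := codomK fx.
rewrite /chart_map /chart_map_dom /= fx' fK fwdK //; do 2 split => //.
exact: codom_fwd.
Qed.

Lemma holo_chart_map : holo_on M (chart_map_dom c c' f) (chart_map c c' f).
Proof.
move=> x Ux; split; first exact: chart_map_continuous.
have [cx fx] := Ux; have [cx' fx'] := codomK fx.
set x' := chart_map c c' f x.
have d1 := differentiable_transition (atlas_chart_at M x) ac (dom_chart_at M x) cx.
have d3 := differentiable_transition ac' (atlas_chart_at M x') cx' (dom_chart_at M x').
have d2 : differentiable (f \o transition (chart_at M x) c) (fwd (chart_at M x) x).
  exact: (differentiable_comp d1 (df _)).
have e2 : (f \o transition (chart_at M x) c) (fwd (chart_at M x) x) = fwd c' x'.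
  by rewrite /= transition_fwd ?fx' //; exact: dom_chart_at.
rewrite -e2 in d3; exact: (differentiable_comp d2 d3).
Qed.

End ChartMap.

Lemma biholomorphism_chart_map c c' (f g : V -> V) : atlas M c -> atlas M c' ->
  (forall z, differentiable f z) -> (forall z, differentiable g z) ->
  cancel f g -> cancel g f ->
  biholomorphism M (chart_map_dom c c' f) (chart_map_dom c' c g)
    (chart_map c c' f) (chart_map c' c g).
Proof.
move=> ac ac' df dg fK gK; split; first by split; exact: open_chart_map_dom.
- by move=> x; exact: chart_map_mem.
- by move=> x; exact: chart_map_mem.
- exact: holo_chart_map.
- exact: holo_chart_map.
Qed.

(** [covector_pull] refers to the preferred charts. The chain rule factors its differential as
    transition, [f], transition; the two transitions are absorbed by [covector_in] on either
    side. *)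
Lemma covector_pull_chart_map c c' (f : V -> V) x alpha : atlas M c -> atlas M c' ->
  (forall z, differentiable f z) -> chart_map_dom c c' f x ->
  covector_in M c x (covector_pull M (chart_map c c' f) x alpha) =
  ext_pull ('d f (fwd c x)) (covector_in M c' (chart_map c c' f x) alpha).
Proof.
move=> ac ac' df [cx fx]; have [cx' fx'] := codomK fx.
set x' := chart_map c c' f x; set e := chart_at M x; set e' := chart_at M x'.
have ae : atlas M e by exact: atlas_chart_at.
have ae' : atlas M e' by exact: atlas_chart_at.
have ex : dom e x by exact: dom_chart_at.
have ex' : dom e' x' by exact: dom_chart_at.
have d1 := differentiable_transition ae ac ex cx.
have d3 := differentiable_transition ac' ae' cx' ex'.
have e3 : fwd c' x' = f (fwd c x) by [].
have d2 : differentiable (f \o transition e c) (fwd e x).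
  exact: (differentiable_comp d1 (df _)).
have e2 : (f \o transition e c) (fwd e x) = fwd c' x'.
  by rewrite /= (transition_fwd _ ex) e3.
have d3' : differentiable (transition c' e') ((f \o transition e c) (fwd e x)).
  rewrite e2; exact: d3.
have L : 'd (local_expr M (chart_map c c' f) x) (fwd e x) =
    'd (transition c' e') (fwd c' x') \o
      ('d f (fwd c x) \o 'd (transition e c) (fwd e x)) :> (V -> V).
  apply: (etrans (diff_comp d2 d3')); rewrite e2; congr (_ \o _).
  by apply: (etrans (diff_comp d1 (df _))); rewrite (transition_fwd _ ex).
apply: (etrans (esym (ext_pull_comp _ _ _))); apply: (etrans _ (ext_pull_comp _ _ _)).
have T : 'd (transition e c) (fwd e x) \o 'd (transition c e) (fwd c x) = id :> (V -> V).
  by rewrite -(diff_transition_comp ac ae ac cx ex cx) (diff_transition_id cx).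
have LT := congr1 (fun h : V -> V => h \o 'd (transition c e) (fwd c x)) L.
have RT := congr1 (fun h : V -> V =>
  'd (transition c' e') (fwd c' x') \o ('d f (fwd c x) \o h)) T.
exact: (congr1 (fun h : V -> V => ext_pull h alpha) (etrans LT RT)).
Qed.

End ChartMaps.

(** * Natural operators in a chart *)

Section Jets.
Variables (R : realType) (n : nat).
Local Notation V := 'rV[R[i]]_n.
Implicit Types (f g : V -> R[i]) (y z : V) (i : 'I_n).

Lemma near_pderiv i f g z : (\forall u \near z, f u = g u) ->
  \forall u \near z, pderiv i f u = pderiv i g u.
Proof. by move=> /near_join fg; near=> u; apply: near_eq_derive; near: u.
Unshelve. all: by end_near. Qed.

Lemma near_mpderiv (a : 'I_n -> nat) f g z : (\forall u \near z, f u = g u) ->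
  mpderiv a f z = mpderiv a g z.
Proof.
move=> fg; apply: (@nbhs_singleton _ z (fun u => mpderiv a f u = mpderiv a g u)).
rewrite /mpderiv; elim: (enum 'I_n) => [//|i s IH] /=.
by elim: (a i) => [//|k IHk] /=; exact: near_pderiv.
Qed.

Lemma eq_mpderiv (a b : 'I_n -> nat) f : a =1 b -> mpderiv a f = mpderiv b f.
Proof. by move=> /funext ->. Qed.

Lemma pderiv_shift i f y : pderiv i (fun z => f (z - y)) = (fun z => pderiv i f (z - y)).
Proof.
apply/funext => z; rewrite /pderiv /derive.
apply: (congr1 (fun g : R[i] -> R[i] => lim (g @ (0 : R[i])^'))).
by apply/funext => h /=; rewrite addrA.
Qed.

Lemma mpderiv_shift a f y : mpderiv a (fun z => f (z - y)) = (fun z => mpderiv a f (z - y)).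
Proof.
rewrite /mpderiv; elim: (enum 'I_n) => [//|i s IH] /=; rewrite IH.
by elim: (a i) => [//|k IHk] /=; rewrite IHk pderiv_shift.
Qed.

(** Every jet has a polynomial representative, so the conditions can be imposed on all of C^n,
    without neighbourhoods. *)
Definition entire_form p (w : V -> extalg R n) : Prop :=
  (forall z, ext_homog p (w z)) /\ (forall z I, differentiable (fun u => w u I) z).

End Jets.

Section OperatorInChart.
Variables (R : realType) (n : nat) (X : topologicalType).
Variable M : complex_manifold R n X.
Variables (r p q : nat) (P : X -> set (X -> extalg R n) -> extalg R n).
Local Notation V := 'rV[R[i]]_n.
Implicit Types (x : X) (w : V -> extalg R n).

Definition centre x : V := fwd (chart_at M x) x.

(** The centre of the chart is moved to the origin, so that the operators at different points act on
    the same forms on C^n and can be compared. *)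
Definition op_at x w : extalg R n :=
  P x (jet M r p x (form_of M (chart_at M x) (fun z => w (z - centre x)))).

Lemma jet_eq x (v v' : X -> extalg R n) : same_jet M r x v v' ->
  jet M r p x v = jet M r p x v'.
Proof.
by move=> vv'; apply/seteqP; split => u [hu su]; split => // a ha I; rewrite -su // vv'.
Qed.

Lemma same_jet_near x (v v' : X -> extalg R n) :
  (\forall z \near centre x, form_in M (chart_at M x) v z = form_in M (chart_at M x) v' z) ->
  same_jet M r x v v'.
Proof.
move=> vv' a _ I; apply: near_mpderiv; near=> z.
by have -> : form_in M (chart_at M x) v z = form_in M (chart_at M x) v' z by near: z.
Unshelve. all: by end_near. Qed.

Lemma near_form_in_of x (eta : V -> extalg R n) :
  \forall z \near centre x, form_in M (chart_at M x) (form_of M (chart_at M x) eta) z = eta z.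
Proof.
near=> z; apply: form_in_of; first exact: atlas_chart_at.
by near: z; apply: near_codom; exact: dom_chart_at.
Unshelve. all: by end_near. Qed.

Lemma holo_form_of x w : entire_form p w ->
  holo_form M p x (form_of M (chart_at M x) (fun z => w (z - centre x))).
Proof.
move=> [hw dw]; split; first by near=> x'; apply: homog_pull; exact: hw.
have nf := near_join (near_form_in_of x (fun z => w (z - centre x))).
near=> z => I.
apply: (@near_differentiable _ _ _ ((fun u => w u I) \o (fun z => z - centre x))).
  have : \forall u \near z, form_in M (chart_at M x) (form_of M (chart_at M x)
    (fun z => w (z - centre x))) u = w (u - centre x) by near: z.
  by apply: filterS => u /= ->.
apply: differentiable_comp; last exact: dw.
apply: differentiableB => //; exact: differentiable_cst.
Unshelve. all: by end_near. Qed.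

Hypothesis P_natural : natural_operator M r p q P.

Lemma op_at_homog x w : entire_form p w -> ext_homog q (op_at x w).
Proof. by move=> ew; apply: (operator_homog P_natural); exact: holo_form_of. Qed.

Lemma op_at_form_in x v : holo_form M p x v ->
  P x (jet M r p x v) = op_at x (fun z => form_in M (chart_at M x) v (z + centre x)).
Proof.
move=> hv; rewrite /op_at; under [X in form_of _ _ X]eq_fun do rewrite subrK.
congr (P x _); apply: jet_eq; apply: same_jet_near.
by have := near_form_in_of x (form_in M (chart_at M x) v); apply: filterS => z ->.
Qed.

Lemma op_at_jet x w w' :
  (forall a : 'I_n -> nat, (\sum_i a i <= r)%N -> forall I : {set 'I_n},
    mpderiv a (fun z => w z I) 0 = mpderiv a (fun z => w' z I) 0) ->
  op_at x w = op_at x w'.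
Proof.
move=> ww'; rewrite /op_at; congr (P x _); apply: jet_eq => a ha I.
have H u : mpderiv (fun i => a i) (fun z => form_in M (chart_at M x)
      (form_of M (chart_at M x) (fun z => u (z - centre x))) z I) (centre x) =
    mpderiv (fun i => a i) (fun z => u z I) 0.
  rewrite (near_mpderiv _ (g := fun z => u (z - centre x) I)).
    by rewrite (mpderiv_shift _ (fun z => u z I)) subrr.
  by have := near_form_in_of x (fun z => u (z - centre x)); apply: filterS => z ->.
by rewrite !H ww'.
Qed.

(** Naturality under the local biholomorphism from [x] to [x'] whose inverse is affine with linear
    part [A] in the two charts. Keeping both points gives two results at once: independence of the
    point for [A] = 1, linear equivariance for [x] = [x']. *)
Lemma op_at_affine x x' (A : 'M[R[i]]_n) w : A \in unitmx -> entire_form p w ->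
  op_at x' (fun z => ext_pull (mulmxr A) (w (z *m A))) = ext_pull (mulmxr A) (op_at x w).
Proof.
move=> uA ew.
pose c := chart_at M x; pose c' := chart_at M x'.
pose f := affine_map (centre x) (centre x') A.
pose g := affine_map (centre x') (centre x) (invmx A).
have [ac ac'] : atlas M c /\ atlas M c' by split; exact: atlas_chart_at.
have [cx cx'] : dom c x /\ dom c' x' by split; exact: dom_chart_at.
have fK : cancel f g by exact: affine_mapK.
have gK : cancel g f.
  by have := @affine_mapK R n (centre x') (centre x) (invmx A); rewrite invmxK unitmx_inv; apply.
have df z : differentiable f z by exact: differentiable_affine.
have dg z : differentiable g z by exact: differentiable_affine.
have fx' : f (centre x') = centre x by rewrite /f /affine_map subrr mul0mx addr0.
have gx : g (centre x) = centre x' by rewrite /g /affine_map subrr mul0mx addr0.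
have Ux : chart_map_dom c c' g x.
  by split => //; rewrite -/(centre x) gx; exact: codom_fwd.
have Vx' : chart_map_dom c' c f x'.
  by split => //; rewrite -/(centre x') fx'; exact: codom_fwd.
have tx : chart_map c c' g x = x'.
  by rewrite /chart_map /= -/(centre x) gx /centre fwdK.
have t'x' : chart_map c' c f x' = x.
  by rewrite /chart_map /= -/(centre x') fx' /centre fwdK.
have biholo := biholomorphism_chart_map ac ac' dg df gK fK.
have := operator_natural P_natural biholo Ux (holo_form_of x ew).
rewrite tx -/c -/(op_at x w) => natE.
have -> : ext_pull (mulmxr A) (op_at x w) = covector_pull M (chart_map c' c f) x' (op_at x w).
  rewrite -[RHS](covector_in_chart_at M x').
  apply: (etrans _ (esym (covector_pull_chart_map _ ac' ac df Vx'))).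
  rewrite t'x' covector_in_chart_at.
  exact: (congr1 (fun h : V -> V => ext_pull h _) (esym (diff_affine _ _ _ _))).
apply: (etrans _ natE); apply: (congr1 (P x')); apply: jet_eq; apply: same_jet_near.
have nc' : \forall z \near centre x', (fwd c' @` dom c') z by exact: near_codom.
have nc : \forall z \near centre x', (fwd c @` dom c) (f z).
  have cf : f z @[z --> centre x'] --> f (centre x') by exact: differentiable_continuous.
  by apply: cf; rewrite fx'; exact: near_codom.
near=> z.
have cz' : (fwd c' @` dom c') z by near: z.
have cz : (fwd c @` dom c) (f z) by near: z.
apply: (etrans (form_in_of _ ac' cz')).
have [dz' fz'] := codomK cz'.
have Vz : chart_map_dom c' c f (bwd c' z) by split => //; rewrite fz'.
apply: (etrans _ (esym (covector_pull_chart_map _ ac' ac df Vz))).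
have tz : chart_map c' c f (bwd c' z) = bwd c (f z) by rewrite /chart_map /= fz'.
rewrite tz; have Fz := form_in_of (fun z => w (z - centre x)) ac cz.
rewrite /form_in in Fz; rewrite Fz.
have -> : f z - centre x = (z - centre x') *m A by rewrite /f /affine_map addrC addKr.
exact: (congr1 (fun h : V -> V => ext_pull h _) (esym (diff_affine _ _ _ _))).
Unshelve. all: by end_near. Qed.

Lemma jet_form_shift y (a : 'rV[R[i]]_#|{: jet_index n r p}|) z :
  jet_form y a z = jet_form 0 a (z - y).
Proof.
apply/ffunP => I; rewrite !ffunE; apply: eq_bigr => k _; congr (_ * _).
by apply: eq_bigr => i _; rewrite !mxE subr0.
Qed.

(** Holomorphy of [P] in the preferred chart, restricted to the fibre of the jet bundle over [x]. *)
Lemma op_at_differentiable x a (I : {set 'I_n}) :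
  differentiable (fun a => op_at x (@jet_form R n r p 0 a) I) a.
Proof.
have := operator_holomorphic P_natural (atlas_chart_at M x) (dom_chart_at M x) a I.
move=> d; have dp : differentiable (fun b : 'rV[R[i]]_#|{: jet_index n r p}| => (centre x, b)) a.
  by apply: differentiable_pair => //; exact: differentiable_cst.
have := differentiable_comp dp d.
rewrite (_ : _ \o _ = (fun a => op_at x (@jet_form R n r p 0 a) I)) //.
apply/funext => b; rewrite /= /operator_in /= {1 3}/centre.
rewrite fwdK; last exact: dom_chart_at.
rewrite covector_in_chart_at /op_at; congr (P x (jet M r p x (form_of _ _ _)) I).
by apply/funext => z; rewrite jet_form_shift.
Qed.

End OperatorInChart.

(** * Derivatives of polynomial forms *)

Section Monomials.
Variables (R : realType) (n : nat).
Local Notation V := 'rV[R[i]]_n.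
Implicit Types (a b : 'I_n -> nat) (z : V).

(** The [b]-th derivative of [t ^ a / a!]. *)
Definition dpow (a b : nat) (t : R[i]) : R[i] :=
  if (b <= a)%N then t ^+ (a - b) / (a - b)`!%:R else 0.

Lemma is_derive_dpow (a b : nat) (t : R[i]) : is_derive t (1 : R[i]) (dpow a b) (dpow a b.+1 t).
Proof.
rewrite /dpow; have [ba|ab] := leqP b a; last first.
  by rewrite leqNgt (leq_trans ab) //; exact: is_derive_cst.
have -> : (fun t : R[i] => t ^+ (a - b) / (a - b)`!%:R) =
    (@GRing.exp R[i] ^~ (a - b)%N) * cst (a - b)`!%:R^-1 by [].
have dp : is_derive t (1 : R[i]) (@GRing.exp R[i] ^~ (a - b)%N)
    ('D_1 (@GRing.exp R[i] ^~ (a - b)%N) t).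
  by apply: derivableP; exact: exprn_derivable.
have dc := @is_derive_cst R[i] R[i] R[i] ((a - b)`!%:R^-1) t 1.
have dm := is_deriveM dp dc.
apply: (is_derive_eq dm).
rewrite exp_derive scaler0 add0r.
case: ltngtP ba => [ba _|//|<- _]; last by rewrite subnn scale0r scale0r scaler0.
rewrite subnS; case: (a - b)%N (subn_gt0 b a) => [|m _]; first by rewrite ba.
rewrite /= factS natrM /GRing.scale /= mulr1; move: (t ^+ m) => u.
have : (m.+1%:R : R[i]) != 0 by rewrite pnatr_eq0.
have : (m`!%:R : R[i]) != 0 by rewrite pnatr_eq0 -lt0n fact_gt0.
move: (m.+1%:R : R[i]) (m`!%:R : R[i]) => d f f0 d0.
by field; rewrite f0 d0.
Qed.

Definition dmono a b z : R[i] := \prod_j dpow (a j) (b j) (z 0 j).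

Lemma is_derive_sum_seq (T : Type) (s : seq T) (Q : pred T) (V' W' : normedModType R[i])
    (F : T -> V' -> W') (dF : T -> W') (x v : V') :
  (forall k, Q k -> is_derive x v (F k) (dF k)) ->
  is_derive x v (fun u : V' => \sum_(k <- s | Q k) F k u) (\sum_(k <- s | Q k) dF k).
Proof.
move=> dFk; elim: s => [|k s IH].
  rewrite big_nil (_ : (fun u : V' => _) = cst 0); first exact: is_derive_cst.
  by apply/funext => z; rewrite big_nil.
rewrite big_cons (_ : (fun u : V' => _) =
    if Q k then F k + (fun u : V' => \sum_(k <- s | Q k) F k u)
    else (fun u : V' => \sum_(k <- s | Q k) F k u)).
  by case: ifP => // Qk; apply: is_deriveD; exact: dFk.
by apply/funext => z; rewrite big_cons; case: ifP.
Qed.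

Definition incr b (i : 'I_n) (k : nat) : 'I_n -> nat := fun j => (b j + (j == i) * k)%N.

(** Only the coordinate [i] varies, which leaves a derivative in one variable. The result has the
    same form as the function differentiated, so the lemma can be iterated. *)
Lemma pderiv_sum_dmono (T : Type) (s : seq T) (Q : pred T) (c : T -> R[i])
    (a : T -> 'I_n -> nat) b i :
  pderiv i (fun z => \sum_(k <- s | Q k) c k * dmono (a k) b z) =
  (fun z => \sum_(k <- s | Q k) c k * dmono (a k) (incr b i 1) z).
Proof.
apply/funext => z.
pose C k := c k * \prod_(j | j != i) dpow (a k j) (b j) (z 0 j).
have E1 t : \sum_(k <- s | Q k) c k * dmono (a k) b (z + (t - z 0 i) *: delta_mx 0 i) =
    \sum_(k <- s | Q k) C k * dpow (a k i) (b i) t.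
  apply: eq_bigr => k _; rewrite /dmono (bigD1 i) //= !mxE !eqxx mulr1 addrC subrK.
  rewrite /C -!mulrA; congr (_ * _); rewrite mulrC; congr (_ * _).
  by apply: eq_bigr => j ji; rewrite !mxE eqxx (negPf ji) mulr0 addr0.
have -> : \sum_(k <- s | Q k) c k * dmono (a k) (incr b i 1) z =
    \sum_(k <- s | Q k) C k * dpow (a k i) (b i).+1 (z 0 i).
  apply: eq_bigr => k _; rewrite /dmono (bigD1 i) //= /incr eqxx mul1n addn1.
  rewrite /C -!mulrA; congr (_ * _); rewrite mulrC; congr (_ * _).
  by apply: eq_bigr => j ji; rewrite (negPf ji) mul0n addn0.
transitivity ('D_1 (fun t => \sum_(k <- s | Q k) C k * dpow (a k i) (b i) t) (z 0 i)).
  rewrite /pderiv /derive; apply: (congr1 (fun g : R[i] -> R[i] => lim (g @ (0 : R[i])^'))).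
  apply/funext => h; congr (_ *: (_ - _)).
    rewrite /= -E1; congr (\sum_(k <- s | Q k) _ * dmono _ _ _) .
    by rewrite [h *: 1]mulr1 addrK addrC.
  by rewrite -E1 subrr scale0r addr0.
apply: derive_val; apply: is_derive_sum_seq => k _.
have dk := is_derive_dpow (a k i) (b i) (z 0 i).
have := is_deriveM (is_derive_cst (C k) (z 0 i) 1) dk.
by rewrite scaler0 addr0.
Qed.

Lemma mpderiv_sum_dmono (T : Type) (s : seq T) (Q : pred T) (c : T -> R[i])
    (a : T -> 'I_n -> nat) b :
  mpderiv b (fun z => \sum_(k <- s | Q k) c k * dmono (a k) (fun=> 0%N) z) =
  (fun z => \sum_(k <- s | Q k) c k * dmono (a k) b z).
Proof.
have incr_iter b' i m : iter m (pderiv i)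
      (fun z => \sum_(k <- s | Q k) c k * dmono (a k) b' z) =
    (fun z => \sum_(k <- s | Q k) c k * dmono (a k) (incr b' i m) z).
  elim: m => [|m IH] /=.
    rewrite (_ : incr b' i 0 = b') //; apply/funext => j.
    by rewrite /incr muln0 addn0.
  rewrite IH pderiv_sum_dmono (_ : incr _ _ 1 = incr b' i m.+1) //.
  by apply/funext => j; rewrite /incr -addnA -mulnDr addn1.
rewrite /mpderiv; have := enum_uniq 'I_n.
(* [mpderiv] folds over the list of coordinates; for the induction on that list, [b] is cut off
   outside it. *)
have : b =1 (fun j => if j \in enum 'I_n then b j else 0%N).
  by move=> j; rewrite mem_enum.
move: (enum 'I_n) => l /funext bl ul; rewrite [in RHS]bl {bl}.
elim: l ul => [//|i l IH] /= /andP[il ul].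
rewrite IH // incr_iter; apply/funext => z; apply: eq_bigr => k _.
congr (_ * dmono _ _ _); apply/funext => j; rewrite /incr inE.
by case: eqP => [->|_]; rewrite ?(negPf il) ?mul1n ?mul0n ?addn0.
Qed.

Lemma dmono0 a b : dmono a b 0 = [forall j, a j == b j]%:R.
Proof.
have [/forallP ab|/forallPn[j ab]] := boolP [forall j, a j == b j].
  by rewrite /dmono big1 // => j _; rewrite /dpow (eqP (ab j)) leqnn subnn expr0 divr1.
rewrite /dmono (bigD1 j) //= /dpow mxE expr0n subn_eq0.
by case: ltngtP ab => //= _ _; rewrite !mul0r.
Qed.

Lemma differentiable_bigsum (V' : normedModType R[i]) (W' : normedModType R[i])
    (T : Type) (s : seq T) (Q : pred T) (F : T -> V' -> W') v :
  (forall k, Q k -> differentiable (F k) v) ->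
  differentiable (fun u => \sum_(k <- s | Q k) F k u) v.
Proof.
move=> dF; elim: s => [|k s IH].
  by under eq_fun do rewrite big_nil; exact: differentiable_cst.
under eq_fun do rewrite big_cons; case: (boolP (Q k)) => // Qk.
by apply: differentiableD => //; exact: dF.
Qed.

Lemma differentiable_bigprod (V' : normedModType R[i]) (T : Type) (s : seq T)
    (F : T -> V' -> R[i]) v :
  (forall k, differentiable (F k) v) ->
  differentiable (fun u => \prod_(k <- s) F k u) v.
Proof.
move=> dF; elim: s => [|k s IH].
  by under eq_fun do rewrite big_nil; exact: differentiable_cst.
by under eq_fun do rewrite big_cons; exact: differentiableM.
Qed.

Lemma differentiable_row (V' : normedModType R[i]) N (f : V' -> 'rV[R[i]]_N) v :
  (forall j, differentiable (fun u => f u 0 j) v) -> differentiable f v.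
Proof.
move=> df; have -> : f = (fun u => \sum_j f u 0 j *: delta_mx 0 j).
  by apply/funext => u; rewrite [LHS]row_sum_delta.
by apply: differentiable_bigsum => j _; exact: differentiableZl.
Qed.

Lemma mpderiv0 (f : V -> R[i]) : mpderiv (fun=> 0%N) f = f.
Proof. by rewrite /mpderiv; elim: (enum 'I_n) => //= i s ->. Qed.

Lemma mpderiv_cst0 b : mpderiv b (fun _ : V => 0 : R[i]) = fun=> 0.
Proof.
have p0 i : pderiv i (fun _ : V => 0 : R[i]) = fun=> 0.
  by apply/funext => z; exact: derive_cst.
rewrite /mpderiv; elim: (enum 'I_n) => [//|i s /= ->].
by elim: (b i) => [//|k /= ->].
Qed.

Lemma pderiv_mpderiv i (f : V -> R[i]) : pderiv i f = mpderiv (fun j => nat_of_bool (j == i)) f.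
Proof.
rewrite /mpderiv; have := enum_uniq 'I_n; have : i \in enum 'I_n by rewrite mem_enum.
have foldr0 l : i \notin l ->
    foldr (fun j g => iter (j == i) (pderiv j) g) f l = f.
  by elim: l => [//|j l IH] /=; rewrite inE negb_or eq_sym => /andP[/negPf -> /IH].
elim: (enum 'I_n) => [//|j l IH] /=; rewrite inE => /orP[/eqP <-|il] /andP[jl ul].
  by rewrite eqxx foldr0.
have ji : (j == i) = false by apply: contraNF jl => /eqP ->.
by rewrite ji -(IH il ul).
Qed.

End Monomials.

(** * Coordinates on the space of jets at the origin *)

Section JetForm.
Variables (R : realType) (n r p : nat).
Local Notation V := 'rV[R[i]]_n.
Local Notation J := (jet_index n r p).
Implicit Types (a : 'rV[R[i]]_#|{: J}|) (b : 'I_n -> nat).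

Definition jet_mult (k : J) : 'I_n -> nat := fun i => (val k).1 i.

Lemma jet_form_dmono a (I : {set 'I_n}) : (fun z => jet_form 0 a z I) =
  (fun z => \sum_(k : J | (val k).2 == I) a 0 (enum_rank k) * dmono (jet_mult k) (fun=> 0%N) z).
Proof.
apply/funext => z; rewrite ffunE; apply: eq_bigr => k _; congr (_ * _).
by apply: eq_bigr => i _; rewrite /dpow leq0n subn0 mxE subr0.
Qed.

Lemma mpderiv_jet_form a b (I : {set 'I_n}) : mpderiv b (fun z => jet_form 0 a z I) 0 =
  \sum_(k : J | ((val k).2 == I) && [forall i, jet_mult k i == b i]) a 0 (enum_rank k).
Proof.
rewrite jet_form_dmono mpderiv_sum_dmono big_mkcondr; apply: eq_bigr => k _.
by rewrite dmono0; case: ifP; rewrite ?mulr1 ?mulr0.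
Qed.

Lemma jet_form_entire a : entire_form p (jet_form 0 a).
Proof.
split=> [z I nI|z I].
  rewrite ffunE big1 // => k /eqP kI.
  by have /andP[_] := valP k; rewrite kI (negPf nI).
rewrite jet_form_dmono; apply: differentiable_bigsum => k _.
apply: differentiableM; first exact: differentiable_cst.
apply: differentiable_bigprod => j; rewrite /dpow leq0n subn0.
apply: differentiableM; last exact: differentiable_cst.
by apply: differentiable_pow; exact: differentiable_coord.
Qed.

Definition jet_coord (w : V -> extalg R n) : 'rV[R[i]]_#|{: J}| :=
  \row_s mpderiv (jet_mult (enum_val s)) (fun z => w z (val (enum_val s)).2) 0.

Lemma jet_index_inj (k k' : J) : (val k).2 = (val k').2 -> jet_mult k =1 jet_mult k' -> k = k'.
Proof.
move=> e2 e1; apply: val_inj; apply: (eq_trans (surjective_pairing _)).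
rewrite [RHS]surjective_pairing e2; congr (_, _).
by apply/ffunP => i; apply: val_inj; exact: e1.
Qed.

Lemma jet_index_of b (I : {set 'I_n}) : (\sum_i b i <= r)%N -> #|I| = p ->
  exists2 k : J, jet_mult k =1 b & (val k).2 = I.
Proof.
move=> br Ip; have bi i : (b i < r.+1)%N.
  by rewrite ltnS (leq_trans _ br) // (bigD1 i) //= leq_addr.
pose f := [ffun i => Ordinal (bi i)].
have fk : (\sum_i (f, I).1 i <= r)%N && (#|(f, I).2| == p).
  by rewrite /= Ip eqxx andbT (eq_bigr b) // => i _; rewrite ffunE.
by exists (exist _ (f, I) fk) => // i; rewrite /jet_mult /= ffunE.
Qed.

(** The right-hand side is the Taylor polynomial of [w]. Homogeneity near 0 settles the components
    of degree other than [p], which have no coordinate in [jet_index]. *)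
Lemma mpderiv_jet_coord (w : V -> extalg R n) b (I : {set 'I_n}) :
  (\forall z \near (0 : V), ext_homog p (w z)) -> (\sum_i b i <= r)%N ->
  mpderiv b (fun z => w z I) 0 = mpderiv b (fun z => jet_form 0 (jet_coord w) z I) 0.
Proof.
move=> hw br; rewrite mpderiv_jet_form; have [Ip|Ip] := eqVneq #|I| p.
  have [k kb kI] := jet_index_of br Ip.
  rewrite (big_pred1 k) => [|k']; last first.
    apply/andP/eqP => [[/eqP k'I /forallP k'b]|->]; last first.
      by rewrite kI eqxx; split => //; apply/forallP => i; rewrite kb.
    by apply: jet_index_inj => [|i]; rewrite ?k'I // (eqP (k'b i)) kb.
  by rewrite mxE enum_rankK kI (eq_mpderiv _ kb).
rewrite big1 => [|k /andP[/eqP kI _]]; last first.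
  by have /andP[_] := valP k; rewrite kI (negPf Ip).
rewrite (near_mpderiv _ (g := fun=> 0)) ?mpderiv_cst0 //.
by apply: filterS hw => z; apply.
Qed.

End JetForm.

(** * Permutations of the coordinates *)

Section ListForms.
Import mathcomp.boot.fintype mathcomp.boot.finset.
Local Close Scope classical_set_scope.
Variables (R : realType) (n : nat).
Local Notation V := 'rV[R[i]]_n.
Local Notation E := (extalg R n).
Local Notation dxs := (@dxs R n).
Local Notation ext_base := (@ext_base R n).
Implicit Types (l : seq 'I_n) (s : {perm 'I_n}) (I K : {set 'I_n}).

Lemma dxs_cat l l' : dxs (l ++ l') = dxs l * dxs l'.
Proof. exact: big_cat. Qed.

Lemma dxs_nil : dxs [::] = 1.
Proof. exact: big_nil. Qed.

Lemma dxs_cons i l : dxs (i :: l) = ext_base [set i] * dxs l.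
Proof. exact: big_cons. Qed.

Lemma dxs_sqr l : l != [::] -> dxs l * dxs l = 0.
Proof.
case: l => // i l _; rewrite dxs_cons mulrA -(mulrA (ext_base _)) .
rewrite (graded_comm (@homog_dxs R n l) (homog_base1 R i)).
by rewrite -ext_scalar_sign ext_scalar_comm !mulrA oneform_sqr ?mul0r //; exact: homog_base1.
Qed.

Lemma dxs_base l : uniq l -> exists k, dxs l = (-1) ^+ k * ext_base [set x in l].
Proof.
elim: l => [|i l IH] /= => [_|/andP[il /IH[k ek]]].
  by exists 0%N; rewrite expr0 mul1r ext_base_enum set_nil enum_set0.
exists (k + inversions [set i] [set x in l])%N.
rewrite dxs_cons ek mulrA -ext_scalar_sign -ext_scalar_comm -mulrA ext_base_mul ?inE // mulrA.
by rewrite ext_scalar_sign -exprD set_cons.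
Qed.

Definition dxs_sign l : R[i] := dxs l [set x in l].

Lemma dxsE l : uniq l -> dxs l = ext_scalar n (dxs_sign l) * ext_base [set x in l].
Proof.
move=> /dxs_base[k ek]; rewrite /dxs_sign ek -ext_scalar_sign; congr (ext_scalar n _ * _).
by rewrite ext_scalarM ext_baseE eqxx mulr1.
Qed.

Lemma dxs_sign_neq0 l : uniq l -> dxs_sign l != 0.
Proof.
move=> /dxs_base[k ek]; rewrite /dxs_sign ek -ext_scalar_sign ext_scalarM ext_baseE eqxx mulr1.
by rewrite signr_eq0.
Qed.

(** The inverse makes the pull-back send dx_i to dx_(s i), since row vectors are multiplied on the
    right. *)
Definition perm_pull s : 'M[R[i]]_n := perm_mx s^-1%g.

Lemma perm_pull_unit s : perm_pull s \in unitmx.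
Proof. exact: unitmx_perm. Qed.

Lemma perm_pullE s (z : V) j : (z *m perm_pull s) 0 j = z 0 (s j).
Proof. by rewrite /perm_pull -col_permE mxE. Qed.

Lemma pull_dx_perm s i : pull_dx (mulmxr (perm_pull s)) i = ext_base [set s i].
Proof.
rewrite pull_dxE (bigD1 (s i)) //= big1 ?addr0 => [|j js].
  by rewrite perm_pullE mxE !eqxx ext_scalar1 mul1r.
by rewrite perm_pullE mxE eqxx eq_sym (negPf js) ext_scalar0 mul0r.
Qed.

Lemma ext_pull_perm s l : ext_pull (mulmxr (perm_pull s)) (dxs l) = dxs (map s l).
Proof.
elim: l => [|i l IH] /=; first by rewrite dxs_nil ext_pull1.
by rewrite !dxs_cons ext_pullM ext_pull_dx pull_dx_perm IH.
Qed.

Lemma set_map s l : [set x in map s l] = s @: [set x in l].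
Proof.
apply/setP => x; rewrite inE; apply/mapP/imsetP => -[y yl ->]; exists y => //;
by move: yl; rewrite inE.
Qed.

(** Coefficients refer to increasing order, lists to their own order; [dxs_sign] converts between
    the two. Both signs are kept as factors to avoid division. *)
Lemma ext_pull_perm_sign s l (a : E) : uniq l ->
  ext_pull (mulmxr (perm_pull s)) a [set x in map s l] * dxs_sign l =
  a [set x in l] * dxs_sign (map s l).
Proof.
move=> ul; have usl : uniq (map s l) by rewrite map_inj_uniq //; exact: perm_inj.
pose K := [set x in l].
have comp I : ext_pull (mulmxr (perm_pull s)) (ext_base I) [set x in map s l] * dxs_sign l =
    (I == K)%:R * dxs_sign (map s l).
  have [->|IK] := eqVneq I K.
    by rewrite mul1r {2}/dxs_sign -ext_pull_perm (dxsE ul) ext_pullZ ext_scalarM mulrC.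
  have uI : uniq (map s (enum I)) by rewrite map_inj_uniq ?enum_uniq //; exact: perm_inj.
  rewrite ext_base_enum ext_pull_perm dxsE // ext_scalarM ext_baseE set_map.
  rewrite [X in (_ == X)]set_map (inj_eq (imset_inj perm_inj)).
  have -> : [set x in enum I] = I by apply/setP => x; rewrite inE mem_enum.
  by rewrite eq_sym (negPf IK) mulr0 !mul0r.
rewrite (ext_decomp a) ext_pull_sum !extalg_sum !mulr_suml; apply: eq_bigr => I _.
rewrite ext_pullZ !ext_scalarM -mulrA comp ext_baseE -/K !mulrA; congr (_ * _ * _).
by rewrite eq_sym.
Qed.

(** Appending the complements gives two enumerations of all coordinates, which the permutation
    matches entry by entry. *)
Lemma perm_of_seq l l' : uniq l -> uniq l' -> size l = size l' ->
  exists s, map s l = l'.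
Proof.
move=> ul ul' sl.
pose c := [seq x <- enum 'I_n | x \notin l]; pose c' := [seq x <- enum 'I_n | x \notin l'].
have full k (uk : uniq k) : perm_eq (k ++ [seq x <- enum 'I_n | x \notin k]) (enum 'I_n).
  have u0 : uniq (enum 'I_n) by exact: enum_uniq.
  apply: uniq_perm => // [|x]; last by rewrite mem_cat mem_filter mem_enum andbT orbN.
  rewrite cat_uniq uk (filter_uniq _ u0) andbT /=.
  by apply/hasPn => x; rewrite mem_filter => /andP[].
have ulc : uniq (l ++ c) by rewrite (perm_uniq (full l ul)); exact: enum_uniq.
have ulc' : uniq (l' ++ c') by rewrite (perm_uniq (full l' ul')); exact: enum_uniq.
have slc : size (l ++ c) = size (l' ++ c').
  by rewrite (perm_size (full l ul)) (perm_size (full l' ul')).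
have memc x : x \in l ++ c by rewrite (perm_mem (full l ul)) mem_enum.
have memc' x : x \in l' ++ c' by rewrite (perm_mem (full l' ul')) mem_enum.
pose f x := nth x (l' ++ c') (index x (l ++ c)).
have finj : injective f.
  move=> x y; rewrite /f (set_nth_default x y) -?slc ?index_mem // => /eqP.
  rewrite nth_uniq -?slc ?index_mem // => /eqP e.
  by rewrite -(nth_index x (memc x)) e nth_index.
exists (perm finj).
case: l ul sl @c ulc slc memc @f finj full => [|x0 l] ul sl c ulc slc memc f finj full.
  by rewrite (size0nil (esym sl)).
apply: (@eq_from_nth _ x0); first by rewrite size_map.
move=> k; rewrite size_map => kl; rewrite (nth_map x0) // permE /f.
set x := nth x0 (x0 :: l) k.
have ix : index x ((x0 :: l) ++ c) = k.
  by rewrite index_cat mem_nth // index_uniq.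
rewrite ix nth_cat -sl kl; apply: set_nth_default; by rewrite -sl.
Qed.

End ListForms.

(** * Block forms and the values of equivariant operators on them *)

Section Blocks.
Import mathcomp.boot.fintype mathcomp.boot.finset.
Local Close Scope classical_set_scope.
Variables (R : realType) (n : nat).
Local Notation V := 'rV[R[i]]_n.
Local Notation E := (extalg R n).
Local Notation dxs := (@dxs R n).
Local Notation ext_base := (@ext_base R n).
Local Notation block := (seq 'I_n * seq 'I_n)%type.
Implicit Types (l : seq 'I_n) (s : {perm 'I_n}) (I K : {set 'I_n}) (b : block) (bs : seq block).

(** A block [(A, I)] stands for the form [z_A dx_I], where the product over [I]
    is taken in the order of the list, so that permuting the coordinates
    introduces no sign. *)
Definition block_seq bs : seq 'I_n := flatten [seq b.1 ++ b.2 | b <- bs].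

Definition block_form bs : V -> E :=
  fun z => \sum_(b <- bs) ext_scalar n (\prod_(i <- b.1) z 0 i) * dxs b.2.

Definition block_perm s b : block := (map s b.1, map s b.2).

Definition block_shape bs : seq (nat * nat) := [seq (size b.1, size b.2) | b <- bs].

Lemma block_form_entire p bs : all (fun b => size b.2 == p) bs ->
  entire_form p (block_form bs).
Proof.
move=> /allP bp; split=> [z|z I].
  rewrite /block_form big_seq; apply: homog_sum => b /bp /eqP <-.
  by apply: homogZ; exact: homog_dxs.
rewrite /block_form (_ : (fun u => _) =
    (fun u : V => \sum_(b <- bs) (\prod_(i <- b.1) u 0 i) * dxs b.2 I)); last first.
  by apply/funext => u; rewrite extalg_sum; apply: eq_bigr => b _; rewrite ext_scalarM.
apply: differentiable_bigsum => b _; apply: differentiableM; last exact: differentiable_cst.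
by apply: differentiable_bigprod => i; exact: differentiable_coord.
Qed.

Lemma block_form_perm s bs :
  (fun z => ext_pull (mulmxr (perm_pull R s)) (block_form bs (z *m perm_pull R s))) =
  block_form (map (block_perm s) bs).
Proof.
apply/funext => z; rewrite /block_form ext_pull_sum big_map; apply: eq_bigr => b _.
rewrite ext_pullZ ext_pull_perm big_map; congr (ext_scalar n _ * _).
by apply: eq_bigr => i _; rewrite perm_pullE.
Qed.

Lemma block_seq_perm s bs : block_seq (map (block_perm s) bs) = map s (block_seq bs).
Proof. by rewrite /block_seq; elim: bs => //= b bs ->; rewrite !map_cat. Qed.

Lemma block_seq_cat bs bs' : block_seq (bs ++ bs') = block_seq bs ++ block_seq bs'.
Proof. by rewrite /block_seq map_cat flatten_cat. Qed.

Lemma perm_block_form bs bs' : perm_eq bs bs' -> block_form bs = block_form bs'.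
Proof. by move=> pbs; apply/funext => z; exact: perm_big. Qed.

Lemma perm_block_seq bs bs' : perm_eq bs bs' -> perm_eq (block_seq bs) (block_seq bs').
Proof. by move=> pbs; apply: perm_flatten; exact: perm_map. Qed.

Lemma perm_set l l' : perm_eq l l' -> [set x in l] = [set x in l'].
Proof. by move=> pl; apply/setP => x; rewrite !inE (perm_mem pl). Qed.

Lemma block_seq_inj bs bs' : block_shape bs = block_shape bs' ->
  block_seq bs = block_seq bs' -> bs = bs'.
Proof.
rewrite /block_shape /block_seq; elim: bs bs' => [|[A I] bs IH] [|[A' I'] bs'] //= [sA sI sh].
move=> /eqP; rewrite !eqseq_cat ?size_cat ?sA ?sI //.
by move=> /andP[/andP[/eqP -> /eqP ->]] /eqP /(IH _ sh) ->.
Qed.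

Lemma block_shape_perm s bs : block_shape (map (block_perm s) bs) = block_shape bs.
Proof. by rewrite /block_shape -map_comp; apply: eq_map => b /=; rewrite !size_map. Qed.

Lemma size_block_seq bs : size (block_seq bs) = sumn [seq ab.1 + ab.2 | ab <- block_shape bs]%N.
Proof.
rewrite /block_seq size_flatten /shape /block_shape -!map_comp; congr sumn.
by apply: eq_map => b /=; rewrite size_cat.
Qed.

Section Equivariant.
Variables (p : nat) (N : (V -> E) -> E).

Definition equivariant := forall (A : 'M[R[i]]_n) (w : V -> E), A \in unitmx ->
  entire_form p w ->
  N (fun z => ext_pull (mulmxr A) (w (z *m A))) = ext_pull (mulmxr A) (N w).

Hypothesis N_equiv : equivariant.

Definition block_val bs : R[i] := N (block_form bs) [set x in block_seq bs].

Lemma perm_block_val bs bs' : perm_eq bs bs' -> block_val bs = block_val bs'.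
Proof.
by move=> pbs; rewrite /block_val (perm_block_form pbs) (perm_set (perm_block_seq pbs)).
Qed.

Definition wf_blocks bs := uniq (block_seq bs) && all (fun b => size b.2 == p) bs.

Lemma perm_wf_blocks bs bs' : perm_eq bs bs' -> wf_blocks bs = wf_blocks bs'.
Proof.
move=> pbs; rewrite /wf_blocks (perm_uniq (perm_block_seq pbs)); congr (_ && _).
exact: perm_all.
Qed.

Lemma block_val_perm s bs : wf_blocks bs ->
  block_val (map (block_perm s) bs) * dxs_sign R (block_seq bs) =
  block_val bs * dxs_sign R (map s (block_seq bs)).
Proof.
move=> /andP[ubs bp]; rewrite /block_val -block_form_perm block_seq_perm.
rewrite (N_equiv (perm_pull_unit R s) (block_form_entire bp)).
exact: ext_pull_perm_sign.
Qed.

(** Two families of blocks of the same shape differ by a permutation of the coordinates, which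
    changes the value by a sign at most. *)
Lemma block_val_shape bs bs' : wf_blocks bs -> wf_blocks bs' ->
  block_shape bs = block_shape bs' -> block_val bs = 0 -> block_val bs' = 0.
Proof.
move=> wbs wbs' sh v0; have [/andP[ubs _] /andP[ubs' _]] := (wbs, wbs').
have [s sbs] := perm_of_seq ubs ubs' (etrans (size_block_seq bs)
  (etrans (congr1 (fun sh => sumn [seq ab.1 + ab.2 | ab <- sh]%N) sh) (esym (size_block_seq bs')))).
have <- : map (block_perm s) bs = bs'.
  by apply: block_seq_inj; rewrite ?block_shape_perm ?block_seq_perm.
have := block_val_perm s wbs; rewrite v0 mul0r => /eqP.
by rewrite mulf_eq0 (negPf (dxs_sign_neq0 R ubs)) orbF => /eqP.
Qed.

(** The permutation taking [bs] to [bs'] preserves the form and reverses dx_K, so the value is its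
    own opposite. *)
Lemma block_val_alternating bs bs' : wf_blocks bs -> block_shape bs = block_shape bs' ->
  perm_eq (block_seq bs) (block_seq bs') -> block_form bs = block_form bs' ->
  dxs (block_seq bs') = - dxs (block_seq bs) -> block_val bs = 0.
Proof.
move=> wbs sh pl fE dE; have [ubs _] := andP wbs.
have ubs' : uniq (block_seq bs') by rewrite -(perm_uniq pl).
have [s sbs] := perm_of_seq ubs ubs' (perm_size pl).
have eb : map (block_perm s) bs = bs'.
  by apply: block_seq_inj; rewrite ?block_shape_perm ?block_seq_perm.
have := block_val_perm s wbs; rewrite eb sbs /block_val -fE -(perm_set pl).
rewrite -/(block_val bs) /(dxs_sign R (block_seq bs')) dE extalgN -(perm_set pl).
move=> /eqP; rewrite mulrN -addr_eq0 -mulr2n mulrn_eq0 /= mulf_eq0.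
by rewrite (negPf (dxs_sign_neq0 R ubs)) orbF => /eqP.
Qed.

Lemma block_val_long bs1 bs2 i j (A I : seq 'I_n) :
  wf_blocks (bs1 ++ (i :: j :: A, I) :: bs2) -> block_val (bs1 ++ (i :: j :: A, I) :: bs2) = 0.
Proof.
move=> wbs; apply: (@block_val_alternating _ (bs1 ++ (j :: i :: A, I) :: bs2)) => //.
- by rewrite /block_shape !map_cat.
- rewrite !block_seq_cat perm_cat2l /block_seq /=; apply/seq.permP => x /=.
  by rewrite addnCA.
- apply/funext => z; rewrite /block_form !big_cat !big_cons /=.
  by congr (_ + (ext_scalar n _ * _ + _)); rewrite mulrCA.
- rewrite !block_seq_cat /block_seq /= !(dxs_cat, dxs_cons) -mulrN; congr (_ * _).
  rewrite !mulrA (graded_comm (homog_base1 R j) (homog_base1 R i)) expr1 mulN1r.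
  by rewrite !mulNr.
Qed.

Lemma block_val_odd bs1 bs2 b b' : wf_blocks (bs1 ++ b :: b' :: bs2) ->
  size b.1 = size b'.1 -> size b.2 = size b'.2 -> odd (size (b.1 ++ b.2)) ->
  block_val (bs1 ++ b :: b' :: bs2) = 0.
Proof.
move=> wbs s1 s2 ob; apply: (@block_val_alternating _ (bs1 ++ b' :: b :: bs2)) => //.
- by rewrite /block_shape !map_cat /= s1 s2.
- apply: perm_block_seq; rewrite perm_cat2l; apply/permPl.
  exact: (perm_catCA [:: b] [:: b'] bs2).
- apply: perm_block_form; rewrite perm_cat2l; apply/permPl; exact: (perm_catCA [:: b] [:: b'] bs2).
- have sb : size (b'.1 ++ b'.2) = size (b.1 ++ b.2) by rewrite !size_cat s1 s2.
  rewrite !block_seq_cat /block_seq /= !dxs_cat -!mulrN; congr (_ * _).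
  have := graded_comm (@homog_dxs R n (b'.1 ++ b'.2)) (@homog_dxs R n (b.1 ++ b.2)).
  rewrite sb -signr_odd oddM ob expr1 mulN1r !dxs_cat => c.
  by rewrite [LHS]mulrA c !mulrN mulNr -!mulrA.
Qed.

Lemma block_shape_filter k bs : all (fun b => size b.2 == p) bs ->
  block_shape [seq b <- bs | size b.1 == k] =
  nseq (size [seq b <- bs | size b.1 == k]) (k, p).
Proof.
elim: bs => //= b bs IH /andP[/eqP bp /IH e].
by case: ifP => //= /eqP bk; rewrite e bk bp.
Qed.

Lemma block_val_shape_odd bs a c k : wf_blocks bs -> odd (k + p) -> (1 < a)%N ->
  block_shape bs = c -> forall c1 c2, c = c1 ++ nseq a (k, p) ++ c2 -> block_val bs = 0.
Proof.
move=> wbs okp a1 <- {c} c1 c2 sh.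
(* Two consecutive blocks of shape [(k, p)] stand right after the first [size c1] blocks. *)
have e : bs = take (size c1) bs ++ take 2 (drop (size c1) bs) ++ drop 2 (drop (size c1) bs).
  by rewrite !cat_take_drop.
have : block_shape (take 2 (drop (size c1) bs)) = nseq 2 (k, p).
  rewrite /block_shape map_take map_drop [map _ _]sh drop_size_cat //.
  by case: a a1 {sh} => [|[|a]] //= _; rewrite take0.
case: (take 2 _) e => [|b [|b' [|]]] //= e [b1 b2 b1' b2'].
rewrite e; apply: block_val_odd; rewrite ?b1 ?b2 ?b1' ?b2' //; first by rewrite -[_ ++ _]e.
by rewrite size_cat b1 b2.
Qed.

(** The degrees of nonzero monomials [u ^ a v ^ c]. *)
Definition admissible (a c : nat) := if odd p then (a <= 1)%N else (c <= 1)%N.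

Lemma block_val_vanish q bs : wf_blocks bs -> size (block_seq bs) = q ->
  (forall a c bs', (a * p + c * p.+1)%N = q -> admissible a c -> wf_blocks bs' ->
     block_shape bs' = nseq a (0%N, p) ++ nseq c (1%N, p) -> block_val bs' = 0) ->
  block_val bs = 0.
Proof.
move=> wbs sq std; have [_ bp] := andP wbs.
have [/allP short|/allPn[[A I] bbs]] := boolP (all (fun b => size b.1 <= 1)%N bs); last first.
  case: A bbs => [|i [|j A]] //= bbs _; move: wbs {sq bp}.
  by case/path.splitPr: bbs => bs1 bs2 wbs; exact: block_val_long.
(* Blocks with empty first part are seen by w at the origin, those with one index by dw; listing the
   former first gives the standard shape. *)
pose bu := [seq b <- bs | size b.1 == 0%N]; pose bv := [seq b <- bs | size b.1 == 1%N].
have pbs : perm_eq bs (bu ++ bv).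
  rewrite perm_sym; have -> : bv = [seq b <- bs | predC (fun b => size b.1 == 0%N) b].
    by apply: eq_in_filter => b /short /=; case: (size b.1) => [|[|m]].
  apply/permPl; exact: perm_filterC.
have sh : block_shape (bu ++ bv) = nseq (size bu) (0%N, p) ++ nseq (size bv) (1%N, p).
  by rewrite /block_shape map_cat; congr (_ ++ _); exact: block_shape_filter.
rewrite (perm_block_val pbs); rewrite (perm_wf_blocks pbs) in wbs.
have sq' : (size bu * p + size bv * p.+1)%N = q.
  rewrite -sq (perm_size (perm_block_seq pbs)) size_block_seq sh map_cat sumn_cat.
  by rewrite !map_nseq !sumn_nseq add0n add1n mulnC (mulnC (size bv)).
have [adm|] := boolP (admissible (size bu) (size bv)); first exact: (std _ _ _ sq' adm wbs sh).
(* Failing admissibility means two blocks of equal odd size: [p] for those of type u if [p] is odd,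
   [p.+1] for those of type v if [p] is even. *)
rewrite /admissible; case: ifP => op; rewrite -ltnNge => lt1.
  by apply: (@block_val_shape_odd _ _ _ 0 wbs op lt1 sh [::] _).
apply: (@block_val_shape_odd _ _ _ 1 wbs _ lt1 sh _ [::]); last by rewrite cats0.
by rewrite add1n /= op.
Qed.

End Equivariant.

End Blocks.

(** * Torus weights of jets *)

Section TorusOnJets.
Import mathcomp.boot.fintype mathcomp.boot.finset.
Local Close Scope classical_set_scope.
Variables (R : realType) (n : nat).
Local Notation V := 'rV[R[i]]_n.
Local Notation E := (extalg R n).
Local Notation ext_base := (@ext_base R n).
Implicit Types (I K : {set 'I_n}) (t : R[i]) (k : 'I_n).

Definition torus_mx k t : 'M[R[i]]_n := diag_mx (\row_j (if j == k then t else 1)).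

Lemma torus_mxE k t (z : V) j : (z *m torus_mx k t) 0 j = z 0 j * (if j == k then t else 1).
Proof. by rewrite mul_mx_diag !mxE. Qed.

Lemma torus_mx_unit k t : t != 0 -> torus_mx k t \in unitmx.
Proof.
move=> t0; rewrite unitmxE det_diag unitfE; apply/prodf_neq0 => j _.
by rewrite mxE; case: ifP; rewrite ?oner_neq0.
Qed.

Lemma pull_dx_torus k t i :
  pull_dx (mulmxr (torus_mx k t)) i = ext_scalar n (if i == k then t else 1) * ext_base [set i].
Proof.
rewrite pull_dxE (bigD1 i) //= big1 ?addr0 => [|j ji].
  by rewrite torus_mxE mxE !eqxx mul1r.
by rewrite torus_mxE mxE eqxx eq_sym (negPf ji) mul0r ext_scalar0 mul0r.
Qed.

Lemma ext_pull_torus k t (a : E) K :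
  ext_pull (mulmxr (torus_mx k t)) a K = t ^+ (k \in K) * a K.
Proof.
have pb I : ext_pull (mulmxr (torus_mx k t)) (ext_base I) =
    ext_scalar n (t ^+ (k \in I)) * ext_base I.
  rewrite ext_base_enum ext_pull_dxs -mem_enum; have := enum_uniq I.
  elim: (enum I) => [|i l IH] /=; first by rewrite dxs_nil big_nil expr0 ext_scalar1 mul1r.
  move=> /andP[il /IH e]; rewrite dxs_cons big_cons e pull_dx_torus.
  rewrite -mulrA (mulrA (ext_base _)) -ext_scalar_comm !mulrA -ext_scalarMM.
  congr (ext_scalar n _ * _ * _); rewrite inE [k == i]eq_sym.
  case: (i =P k) => [<-|_]; last by rewrite mul1r.
  by rewrite (negPf il) mulr1.
rewrite [in LHS](ext_decomp a) ext_pull_sum extalg_sum (bigD1 K) //= big1 ?addr0 => [|I IK].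
  by rewrite ext_pullZ pb !ext_scalarM ext_baseE eqxx mulr1 mulrC.
by rewrite ext_pullZ pb !ext_scalarM ext_baseE eq_sym (negPf IK) !mulr0.
Qed.

Variables (r p : nat).
Local Notation J := (jet_index n r p).
Hypothesis p_gt0 : (0 < p)%N.

Definition jet_weight (s : 'I_#|{: J}|) k : nat :=
  (jet_mult (enum_val s) k + (k \in (val (enum_val s)).2))%N.

Lemma jet_form_torus k t (a : 'rV[R[i]]_#|{: J}|) :
  (fun z => ext_pull (mulmxr (torus_mx k t)) (jet_form 0 a (z *m torus_mx k t))) =
  jet_form 0 (torus_act (jet_weight ^~ k) t a).
Proof.
apply/funext => z; apply/ffunP => I; rewrite ext_pull_torus !ffunE mulr_sumr.
apply: eq_bigr => j /eqP jI; rewrite mxE /jet_weight enum_rankK jI exprD -!mulrA.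
rewrite [RHS]mulrCA; congr (_ * _); rewrite [RHS]mulrCA; congr (_ * _).
rewrite (bigD1 k) //= [in RHS](bigD1 k) //= torus_mxE eqxx !mxE !subr0 exprMn.
rewrite -/(jet_mult j k) -!mulrA [LHS]mulrCA; do 3 congr (_ * _).
by apply: eq_bigr => i ik; rewrite torus_mxE (negPf ik) mulr1.
Qed.

Variable N : (V -> E) -> E.
Hypothesis N_equiv : equivariant p N.
Hypothesis N_diff : forall (K : {set 'I_n}) (a : 'rV[R[i]]_#|{: J}|),
  differentiable (fun a => N (jet_form 0 a) K) a.

Definition blocks_of_jets (T : {set 'I_#|{: J}|}) : seq (seq 'I_n * seq 'I_n) :=
  [seq (enum [set i | jet_mult (enum_val s) i == 1%N], enum (val (enum_val s)).2) | s <- enum T].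

(** In an exact partition all multiplicities are at most one, so the 0/1 vector of the partition is
    the jet of a block form, to which the hypothesis applies. *)
Lemma jet_vanish K :
  (forall bs, wf_blocks p bs -> size (block_seq bs) = #|K| -> block_val N bs = 0) ->
  forall a : 'rV[R[i]]_#|{: J}|, N (jet_form 0 a) K = 0.
Proof.
move=> bs0; apply: (@torus_vanish R _ n _ jet_weight K).
- by move=> a; exact: N_diff.
(* As p > 0, each dx_I has a factor, which gives the jet coordinate a positive weight. *)
- move=> s; have /andP[_ /eqP cI] := valP (enum_val s).
  have : (0 < #|(val (enum_val s)).2|)%N by rewrite cI.
  by case/card_gt0P => k kI; exists k; rewrite /jet_weight kI addn1.
- move=> k t a t0; rewrite -jet_form_torus (N_equiv (torus_mx_unit k t0)) ?ext_pull_torus //.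
  exact: jet_form_entire.
move=> T wT; pose bs := blocks_of_jets T.
have mult1 s k : s \in T -> (jet_mult (enum_val s) k <= 1)%N.
  move=> sT; apply: (@leq_trans (k \in K)); last by case: (k \in K).
  by rewrite -wT (bigD1 s) //= /jet_weight -addnA leq_addr.
have cnt k : count_mem k (block_seq bs) = (k \in K).
  rewrite -wT /bs /block_seq /blocks_of_jets -map_comp count_flatten -map_comp.
  rewrite sumnE big_map -big_enum /=; apply: eq_big_seq => s; rewrite mem_enum => sT /=.
  rewrite count_cat !count_uniq_mem ?enum_uniq // !mem_enum inE /jet_weight.
  by have := mult1 s k sT; case: (jet_mult _ k) => [|[|]].
have ubs : uniq (block_seq bs).
  apply: count_mem_uniq => k; rewrite cnt.
  by rewrite -has_pred1 has_count cnt; case: (k \in K).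
have setK : [set x in block_seq bs] = K.
  by apply/setP => k; rewrite inE -has_pred1 has_count cnt; case: (k \in K).
have wbs : wf_blocks p bs.
  rewrite /wf_blocks ubs /=; apply/allP => b /mapP[s _ ->] /=.
  by rewrite -cardE; have /andP[_] := valP (enum_val s).
have sbs : size (block_seq bs) = #|K|.
  by rewrite -setK cardsE; exact/esym/card_uniqP.
have := bs0 bs wbs sbs; rewrite /block_val setK => <-; congr (N _ K).
apply/funext => z; apply/ffunP => I; rewrite ffunE /block_form extalg_sum big_map.
rewrite big_enum (reindex_onto (enum_rank : J -> _) enum_val) /=; last first.
  by move=> s _; exact: enum_valK.
rewrite big_mkcond [RHS]big_mkcond; apply: eq_bigr => k _.
rewrite enum_rankK eqxx andbT mxE; case: (boolP (enum_rank k \in T)) => kT; last first.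
  by rewrite mul0r if_same.
rewrite ext_scalarM -ext_base_enum ext_baseE eq_sym mul1r; case: ifP => _; last by rewrite mulr0.
rewrite mulr1 big_enum /= [RHS]big_mkcond; apply: eq_bigr => i _; rewrite inE.
rewrite mxE subr0; have := mult1 _ i kT; rewrite enum_rankK /jet_mult.
(* The exponents are 0 or 1, so the factorials in [jet_form] are 1. *)
by case: (nat_of_ord _) => [|[|]] //= _; rewrite ?expr0 ?expr1 divr1.
Qed.

End TorusOnJets.

(** * The operators [w ^ a (dw) ^ c] *)

Section MonomialOperator.
Import mathcomp.boot.fintype mathcomp.boot.finset.
Local Close Scope classical_set_scope.
Variables (R : realType) (n : nat).
Local Notation V := 'rV[R[i]]_n.
Local Notation E := (extalg R n).
Local Notation ext_base := (@ext_base R n).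
Local Notation dxs := (@dxs R n).
Implicit Types (I K : {set 'I_n}) (k : 'I_n) (w : V -> E) (z : V).

Definition ext_pderiv k w z : E := [ffun I : {set 'I_n} => pderiv k (fun u => w u I) z].

Lemma ext_dE w z : ext_d w z = \sum_k ext_base [set k] * ext_pderiv k w z.
Proof.
apply/ffunP => K; rewrite ffunE extalg_sum big_mkcond; apply: eq_bigr => k _.
rewrite extalgM; case: ifP => kK.
  rewrite (bigD1 [set k]) ?sub1set //= big1 ?addr0 => [|I /andP[_ Ik]].
    by rewrite ext_baseE eqxx mulr1 ffunE.
  by rewrite ext_baseE (negPf Ik) mulr0 mul0r.
rewrite big1 // => I IK; rewrite ext_baseE.
by case: eqP => [Ik|]; rewrite ?mulr0 ?mul0r //; move: IK; rewrite Ik sub1set kK.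
Qed.

Lemma ext_d_homog p w z : (\forall u \near z, ext_homog p (w u)) ->
  ext_homog p.+1 (ext_d w z).
Proof.
move=> hw; rewrite ext_dE; apply: homog_sum => k _.
apply: (@homogM _ _ 1); first exact: homog_base1.
move=> I nI; rewrite ffunE /pderiv (near_eq_derive (g := fun=> 0)); first exact: derive_cst.
by apply: filterS hw => u; apply.
Qed.

Lemma pderiv_mulmxr (A : 'M[R[i]]_n) (f : V -> R[i]) k : differentiable f 0 ->
  pderiv k (fun z => f (z *m A)) 0 = \sum_j A k j * pderiv j f 0.
Proof.
move=> df; have -> : pderiv k (fun z => f (z *m A)) 0 = 'D_(row k A) f 0.
  rewrite /pderiv /derive; apply: (congr1 (fun g : R[i] -> R[i] => lim (g @ (0 : R[i])^')%classic)).
  by apply/funext => h /=; rewrite !addr0 mul0mx -scalemxAl rowE.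
rewrite deriveE // (row_sum_delta (row k A)) linear_sum; apply: eq_bigr => j _.
by rewrite linearZ mxE /pderiv deriveE.
Qed.

(** A linear pull-back has constant coefficients on the basis, so only the chain rule for the
    components of [w] intervenes. *)
Lemma ext_d_pull p (A : 'M[R[i]]_n) w : entire_form p w ->
  ext_d (fun z => ext_pull (mulmxr A) (w (z *m A))) 0 = ext_pull (mulmxr A) (ext_d w 0).
Proof.
move=> [_ dw].
have dc k : ext_pderiv k (fun z => ext_pull (mulmxr A) (w (z *m A))) 0 =
    ext_pull (mulmxr A) (\sum_j ext_scalar n (A k j) * ext_pderiv j w 0).
  apply/ffunP => I; rewrite ffunE.
  have pE (a : E) : ext_pull (mulmxr A) a I = \sum_J ext_pull (mulmxr A) (ext_base J) I * a J.
    rewrite {1}(ext_decomp a) ext_pull_sum extalg_sum; apply: eq_bigr => J _.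
    by rewrite ext_pullZ ext_scalarM mulrC.
  have e1 : (fun u : V => ext_pull (mulmxr A) (w (u *m A)) I) =
      (fun u : V => \sum_J ext_pull (mulmxr A) (ext_base J) I * w (u *m A) J).
    by apply/funext => u; exact: pE.
  rewrite e1 pE; apply: derive_val; apply: is_derive_sum_seq => J _.
  have -> : (\sum_j ext_scalar n (A k j) * ext_pderiv j w 0) J =
      \sum_j A k j * pderiv j (fun u => w u J) 0.
    by rewrite extalg_sum; apply: eq_bigr => j _; rewrite ext_scalarM ffunE.
  have dJ : differentiable (fun u : V => w (u *m A) J) 0.
    apply: (@differentiable_comp _ _ _ _ (mulmxr A : V -> V) (fun u => w u J)).
      exact: differentiable_mulmxr.
    exact: dw.
  rewrite -(pderiv_mulmxr A k (dw 0 J)).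
  have dD : is_derive (0 : V) (delta_mx 0 k : V) (fun u : V => w (u *m A) J)
      (pderiv k (fun u => w (u *m A) J) 0).
    by apply: derivableP; exact: diff_derivable.
  have dc := is_derive_cst (ext_pull (mulmxr A) (ext_base J) I) (0 : V) (delta_mx 0 k : V).
  have := is_deriveM dc dD; by rewrite scaler0 addr0.
rewrite ext_dE; under eq_bigr => k _ do rewrite dc ext_pull_sum mulr_sumr.
rewrite exchange_big ext_dE ext_pull_sum; apply: eq_bigr => j _ /=.
rewrite ext_pull_dxM pull_dxE mulr_suml; apply: eq_bigr => k _.
rewrite ext_pullZ mulrA -ext_scalar_comm; congr (ext_scalar n _ * _ * _).
by rewrite /= -rowE mxE.
Qed.

Definition ext_monomial a c w : E := w 0 ^+ a * ext_d w 0 ^+ c.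

Lemma ext_monomial_homog p a c w : entire_form p w ->
  ext_homog (a * p + c * p.+1) (ext_monomial a c w).
Proof.
move=> ew; apply: homogM; apply: homogX; first by case: ew.
apply: ext_d_homog; exact: (@filterE _ _ (nbhs_filter _) _ ew.1).
Qed.

Lemma ext_monomial_equivariant p a c : equivariant p (ext_monomial a c).
Proof.
move=> A w _ ew; rewrite /ext_monomial (ext_d_pull A ew) mul0mx.
by rewrite ext_pullM !ext_pullX.
Qed.

Lemma ext_d_mpderiv w K : ext_d w 0 K = \sum_(k in K)
  shuffle_sign R [set k] (K :\ k) *
    mpderiv (fun j => nat_of_bool (j == k)) (fun u => w u (K :\ k)) 0.
Proof. by rewrite ffunE; apply: eq_bigr => k _; rewrite pderiv_mpderiv. Qed.

Lemma ext_monomial_jet a c w w' :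
  (forall b : 'I_n -> nat, (\sum_i b i <= 1)%N -> forall I : {set 'I_n},
    mpderiv b (fun z => w z I) 0 = mpderiv b (fun z => w' z I) 0) ->
  ext_monomial a c w = ext_monomial a c w'.
Proof.
move=> ww'; have e0 : w 0 = w' 0.
  apply/ffunP => I; have := ww' (fun=> 0%N) _ I; rewrite !mpderiv0; apply.
  by rewrite big1.
rewrite /ext_monomial e0; apply: (congr1 (fun e : E => w' 0 ^+ a * e ^+ c)).
apply/ffunP => K; apply: (etrans (ext_d_mpderiv w K)).
apply: (etrans _ (esym (ext_d_mpderiv w' K))).
apply: eq_bigr => k _; apply: (congr1 (fun d => _ * d)).
apply: ww'; rewrite (bigD1 k) //= eqxx big1 // => i /negPf ->; by [].
Qed.

Lemma extalg_differentiableM (W : normedModType R[i]) (f g : W -> E) v :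
  (forall K, differentiable (fun u => f u K) v) ->
  (forall K, differentiable (fun u => g u K) v) ->
  forall K, differentiable (fun u => (f u * g u) K) v.
Proof.
move=> df dg K; rewrite (_ : (fun u => _) = (fun u => \sum_(I : {set 'I_n} | I \subset K)
    shuffle_sign R I (K :\: I) * f u I * g u (K :\: I))); last first.
  by apply/funext => u; exact: extalgM.
apply: differentiable_bigsum => I _; apply: differentiableM; last exact: dg.
by apply: differentiableM; [exact: differentiable_cst|exact: df].
Qed.

Lemma extalg_differentiableX (W : normedModType R[i]) (f : W -> E) a v :
  (forall K, differentiable (fun u => f u K) v) ->
  forall K, differentiable (fun u => (f u ^+ a) K) v.
Proof.
move=> df; elim: a => [|a IH] K.
  by under eq_fun do rewrite expr0; exact: differentiable_cst.
by under eq_fun do rewrite exprS; exact: extalg_differentiableM.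
Qed.

Lemma mpderiv_jet_form_differentiable r p b I (a : 'rV[R[i]]_#|{: jet_index n r p}|) :
  differentiable (fun a : 'rV[R[i]]_#|{: jet_index n r p}| =>
    mpderiv b (fun z => jet_form 0 a z I) 0) a.
Proof.
under eq_fun do rewrite mpderiv_jet_form.
by apply: differentiable_bigsum => j _; exact: differentiable_coord.
Qed.

Lemma ext_monomial_differentiable r p a c K (x : 'rV[R[i]]_#|{: jet_index n r p}|) :
  differentiable (fun x : 'rV[R[i]]_#|{: jet_index n r p}| =>
    ext_monomial a c (jet_form 0 x) K) x.
Proof.
apply: extalg_differentiableM; apply: extalg_differentiableX => {}K.
  rewrite (_ : (fun u => _) = (fun x : 'rV[R[i]]_#|{: jet_index n r p}| =>
    mpderiv (fun=> 0%N) (fun z => jet_form 0 x z K) 0)); last first.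
    by rewrite funeqE => u; rewrite mpderiv0.
  exact: mpderiv_jet_form_differentiable.
under eq_fun do rewrite ext_d_mpderiv.
apply: differentiable_bigsum => k _; apply: differentiableM; first exact: differentiable_cst.
exact: mpderiv_jet_form_differentiable.
Qed.

End MonomialOperator.

Lemma exprS_addl_sqr0 (A : pzRingType) (x y : A) k : x * x = 0 -> y * x = x * y ->
  (x + y) ^+ k.+1 = y ^+ k.+1 + (x * y ^+ k) *+ k.+1.
Proof.
move=> xx yx; elim: k => [|k IH]; first by rewrite !expr1 expr0 mulr1 addrC.
rewrite exprS IH mulrDl !mulrDr !mulrnAr !(mulrA _ x) xx mul0r mul0rn addr0 yx.
by rewrite -(mulrA x y) -!exprS [LHS]addrCA [in RHS]mulrS.
Qed.

(** Only products of distinct terms survive in the expansion. The vanishing of the next power is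
    carried along because the induction uses it. *)
Lemma expr_sum_sqr0 (A : pzRingType) (xs : seq A) :
  (forall x, x \in xs -> x * x = 0) ->
  (forall x y, x \in xs -> y \in xs -> y * x = x * y) ->
  (\sum_(x <- xs) x) ^+ (size xs) = (\prod_(x <- xs) x) *+ (size xs)`! /\
  (\sum_(x <- xs) x) ^+ (size xs).+1 = 0.
Proof.
elim: xs => [|x xs IH] x0 xC; first by rewrite !big_nil expr0 expr1.
have [y xsy|y z ys zs|e1 e2] := IH.
- by apply: x0; rewrite inE xsy orbT.
- by apply: xC; rewrite inE ?ys ?zs orbT.
have xx : x * x = 0 by apply: x0; rewrite mem_head.
have xS : (\sum_(x <- xs) x) * x = x * \sum_(x <- xs) x.
  rewrite mulr_suml mulr_sumr; apply: eq_big_seq => y ys.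
  by apply: xC; rewrite ?mem_head // inE ys orbT.
rewrite !big_cons /=; split; rewrite exprS_addl_sqr0 //.
  by rewrite e2 add0r e1 mulrnAr -mulrnA factS mulnC.
by rewrite e2 exprS e2 mulr0 add0r mulr0 mul0rn.
Qed.

(** * Value of a monomial on a standard partition *)

Section StandardValue.
Import mathcomp.boot.fintype mathcomp.boot.finset.
Local Close Scope classical_set_scope.
Variables (R : realType) (n : nat).
Local Notation V := 'rV[R[i]]_n.
Local Notation E := (extalg R n).
Local Notation ext_base := (@ext_base R n).
Local Notation dxs := (@dxs R n).
Local Notation block := (seq 'I_n * seq 'I_n)%type.
Implicit Types (bs : seq block) (b : block) (l : seq 'I_n).

(** Cut [l] from the left into [a] pieces of length [p], then [c] pieces of length [p.+1] whose
    first index is the coefficient. *)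
Lemma blocks_exist p a c l : size l = (a * p + c * p.+1)%N ->
  exists2 bs, block_shape bs = nseq a (0%N, p) ++ nseq c (1%N, p) & block_seq bs = l.
Proof.
elim: a l => [|a IHa] l.
  elim: c l => [|c IHc] l sl; first by exists [::] => //; rewrite (size0nil sl).
  case: l sl => [|i l] //=; rewrite mul0n add0n mulSn => -[sl].
  have [bs sh e] : exists2 bs, block_shape bs = nseq 0 (0%N, p) ++ nseq c (1%N, p) &
      block_seq bs = drop p l.
    by apply: IHc; rewrite size_drop sl addKn.
  exists (([:: i], take p l) :: bs); last by rewrite /block_seq /= -/(block_seq bs) e cat_take_drop.
  rewrite /block_shape /= -/(block_shape bs) sh size_takel // sl; exact: leq_addr.
rewrite mulSn -addnA => sl.
have [bs sh e] : exists2 bs, block_shape bs = nseq a (0%N, p) ++ nseq c (1%N, p) &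
    block_seq bs = drop p l.
  by apply: IHa; rewrite size_drop sl addKn.
exists (([::], take p l) :: bs); last by rewrite /block_seq /= -/(block_seq bs) e cat_take_drop.
rewrite /block_shape /= -/(block_shape bs) sh size_takel // sl; exact: leq_addr.
Qed.

Lemma block_form0 bs : block_form bs 0 = \sum_(b <- bs | size b.1 == 0%N) dxs b.2 :> E.
Proof.
rewrite /block_form [RHS]big_mkcond; apply: eq_bigr => -[[|i A] I] _ /=.
  by rewrite big_nil ext_scalar1 mul1r.
by rewrite big_cons mxE mul0r ext_scalar0 mul0r.
Qed.

(** The coefficients have degree at most one, so their derivatives are constant, and the index of
    the coefficient becomes the leading dx. *)
Lemma ext_d_block_form bs : all (fun b => size b.1 <= 1)%N bs ->
  ext_d (block_form bs) 0 = \sum_(b <- bs | size b.1 == 1%N) dxs (b.1 ++ b.2) :> E.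
Proof.
move=> /all_filterP short.
have dB k : ext_pderiv k (block_form bs) 0 =
    \sum_(b <- bs | (size b.1 <= 1)%N) ext_scalar n (b.1 == [:: k])%:R * dxs b.2.
  apply/ffunP => I; rewrite ffunE extalg_sum.
  have -> : (fun u => block_form bs u I) = (fun u : V =>
      \sum_(b <- bs | (size b.1 <= 1)%N) (\prod_(i <- b.1) u 0 i) * dxs b.2 I).
    apply/funext => u; rewrite /block_form extalg_sum -[RHS]big_filter short.
    by apply: eq_bigr => b _; rewrite ext_scalarM.
  apply: derive_val; apply: is_derive_sum_seq => -[[|i [|j A]] J] //= _.
    rewrite ext_scalar0 mul0r extalg0; under eq_fun do rewrite big_nil.
    exact: is_derive_cst.
  rewrite ext_scalarM; under eq_fun do rewrite big_seq1.
  have dc : is_derive (0 : V) (delta_mx 0 k : V) (fun u : V => u 0 i) ((k == i)%:R : R[i]).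
    have dci : differentiable (fun u : V => u 0 i) (0 : V) by exact: differentiable_coord.
    have -> : ((k == i)%:R : R[i]) = 'D_(delta_mx 0 k) (fun u : V => u 0 i) (0 : V).
      rewrite /derive; apply/esym/cvg_lim => //.
      have h : (fun h : R[i] => h^-1 *: (((fun u : V => u 0 i) \o shift (0 : V))
            (h *: delta_mx 0 k) - (0 : V) 0 i)) =
          (fun h => h^-1 * (h * (k == i)%:R)).
        by apply/funext => h; rewrite /= !mxE !addr0 subr0 eqxx eq_sym.
      (* The difference quotient is constant away from zero. *)
      rewrite h; apply: cvg_near_cst.
      near=> t; rewrite mulrA mulVf ?mul1r //.
      by near: t; exact: nbhs_dnbhs_neq.
    by apply: derivableP; exact: diff_derivable.
  have := is_deriveM dc (is_derive_cst (dxs J I) (0 : V) (delta_mx 0 k : V)).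
  rewrite scaler0 add0r; congr (is_derive _ _ _ _).
  by rewrite eqseq_cons andbT eq_sym [_ *: _]mulrC.
rewrite ext_dE; under eq_bigr => k _ do rewrite dB mulr_sumr.
rewrite exchange_big /= [RHS]big_mkcond -big_filter short.
apply: eq_big_seq => -[[|i [|j A]] J] bbs //=.
- by rewrite big1 // => k _; rewrite ext_scalar0 mul0r mulr0.
- rewrite (bigD1 i) //= big1 ?addr0 => [|k ki].
    by rewrite eqxx ext_scalar1 mul1r dxs_cons.
  by rewrite eqseq_cons andbT eq_sym (negPf ki) ext_scalar0 mul0r mulr0.
- by move: bbs; rewrite -short mem_filter.
Unshelve. all: by end_near. Qed.

(** In even degree the terms commute and have square zero; in odd degree there is at most one
    term. *)
Lemma expr_sum_dxs m (ls : seq (seq 'I_n)) : (0 < m)%N -> all (fun l => size l == m) ls ->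
  (size ls <= 1)%N || ~~ odd m ->
  (\sum_(l <- ls) dxs l) ^+ size ls = dxs (flatten ls) *+ (size ls)`!.
Proof.
move=> m0 /allP lsm; case/orP => [|em].
  case: ls {lsm} => [|l [|]] //= _; first by rewrite fact0 expr0 mulr1n dxs_nil.
  by rewrite big_seq1 cats0 expr1 factS fact0 mulr1n.
have e : dxs (flatten ls) = \prod_(x <- map dxs ls) x.
  elim: ls {lsm} => [|l ls IH] /=; first by rewrite dxs_nil big_nil.
  by rewrite dxs_cat IH big_cons.
have := @expr_sum_sqr0 _ (map dxs ls); rewrite size_map big_map -e; case=> //.
- move=> x /mapP[l /lsm /eqP lm ->]; apply: dxs_sqr; case: l lm => //= m1.
  by rewrite -m1 in m0.
- move=> x y /mapP[l /lsm /eqP lm ->] /mapP[l' /lsm /eqP lm' ->].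
  rewrite (graded_comm (@homog_dxs R n l') (@homog_dxs R n l)) lm lm'.
  by rewrite -signr_odd oddM (negPf em) mul1r.
Qed.

(** At the origin w sums the first [a] blocks and dw the last [c]; each power contributes the
    factorial of its exponent. *)
Lemma ext_monomial_blocks p a c bs : (0 < p)%N -> admissible p a c ->
  block_shape bs = nseq a (0%N, p) ++ nseq c (1%N, p) ->
  ext_monomial a c (block_form bs) = ext_scalar n (a`! * c`!)%:R * dxs (block_seq bs) :> E.
Proof.
move=> p0 adm sh.
pose bu := take a bs; pose bv := drop a bs.
have ebs : bs = bu ++ bv by rewrite cat_take_drop.
have shu : block_shape bu = nseq a (0%N, p).
  by rewrite /block_shape map_take [map _ _]sh take_size_cat // size_nseq.
have shv : block_shape bv = nseq c (1%N, p).
  by rewrite /block_shape map_drop [map _ _]sh drop_size_cat // size_nseq.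
have mem_shape k m bs' b : block_shape bs' = nseq m (k, p) -> b \in bs' ->
    size b.1 = k /\ size b.2 = p.
  move=> sh' bbs; have : (size b.1, size b.2) \in block_shape bs' by apply/mapP; exists b.
  by rewrite sh' mem_nseq => /andP[_ /eqP[-> ->]].
have su : size bu = a by have := congr1 size shu; rewrite size_map size_nseq.
have sv : size bv = c by have := congr1 size shv; rewrite size_map size_nseq.
have fu b : b \in bu -> size b.1 = 0%N /\ size b.2 = p by exact: (mem_shape _ _ _ _ shu).
have fv b : b \in bv -> size b.1 = 1%N /\ size b.2 = p by exact: (mem_shape _ _ _ _ shv).
pose lu := [seq b.1 ++ b.2 | b <- bu]; pose lv := [seq b.1 ++ b.2 | b <- bv].
have w0 : block_form bs 0 = \sum_(l <- lu) dxs l.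
  rewrite block_form0 ebs big_cat /= [X in _ + X](_ : _ = 0) ?addr0; last first.
    rewrite big_seq_cond big_pred0 //.
    by move=> b; apply/negP => /andP[/fv[->]].
  rewrite big_seq_cond big_map [RHS]big_seq; apply: eq_big => [b|b /andP[/fu[/size0nil -> _] _]] //.
  by case: (boolP (b \in bu)) => // /fu[-> _].
have dw0 : ext_d (block_form bs) 0 = \sum_(l <- lv) dxs l.
  rewrite ext_d_block_form; last first.
    by apply/allP => b; rewrite ebs mem_cat => /orP[/fu[->]|/fv[->]].
  rewrite ebs big_cat /= [X in X + _](_ : _ = 0) ?add0r; last first.
    rewrite big_seq_cond big_pred0 //.
    by move=> b; apply/negP => /andP[/fu[->]].
  rewrite big_seq_cond big_map [RHS]big_seq; apply: eq_bigl => b.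
  by case: (boolP (b \in bv)) => // /fv[-> _].
rewrite /ext_monomial w0 dw0 /admissible in adm *.
have eu : (\sum_(l <- lu) dxs l) ^+ a = dxs (flatten lu) *+ a`!.
  have := @expr_sum_dxs p lu p0; rewrite size_map su; apply.
    by apply/allP => l /mapP[b /fu[b1 b2] ->]; rewrite size_cat b1 b2.
  by move: adm; case: (odd p) => [->|]; rewrite ?orbT.
have ev : (\sum_(l <- lv) dxs l) ^+ c = dxs (flatten lv) *+ c`!.
  have := @expr_sum_dxs p.+1 lv isT; rewrite size_map sv; apply.
    by apply/allP => l /mapP[b /fv[b1 b2] ->]; rewrite size_cat b1 b2.
  by move: adm => /=; case: (odd p) => [_|->] //; rewrite orbT.
rewrite eu ev ebs block_seq_cat dxs_cat mulrnAl mulrnAr -mulrnA mulnC.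
have sn k (x : E) : x *+ k = ext_scalar n k%:R * x.
  elim: k => [|k IH]; first by rewrite ext_scalar0 mul0r.
  by rewrite mulrSr IH mulrSr ext_scalarD mulrDl ext_scalar1 mul1r.
by rewrite sn.
Qed.

Lemma block_val_monomial_neq0 p a c bs : (0 < p)%N -> admissible p a c ->
  block_shape bs = nseq a (0%N, p) ++ nseq c (1%N, p) -> uniq (block_seq bs) ->
  block_val (@ext_monomial R n a c) bs != 0.
Proof.
move=> p0 adm sh ubs; rewrite /block_val (ext_monomial_blocks p0 adm sh) ext_scalarM.
by rewrite mulf_neq0 ?dxs_sign_neq0 // pnatr_eq0 -lt0n muln_gt0 !fact_gt0.
Qed.

End StandardValue.

(** * Anti-commutative polynomials *)

Section AntiCommutative.
Local Close Scope classical_set_scope.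
Variables (R : realType) (m : nat) (deg : 'I_m -> nat).
Implicit Types (s t u : acpoly R m) (a b : R[i]).
Local Notation eqac := (aceq deg).

(** Induction on the derivation of the congruence. The degrees of the [w i] enter in the
    anti-commutation axiom, which becomes [graded_comm]. *)
Lemma acsubst_aceq n (w : 'I_m -> extalg R n) s t : (forall i, ext_homog (deg i) (w i)) ->
  eqac s t -> acsubst w s = acsubst w t.
Proof.
move=> hw; elim=> {s t}.
- by [].
- by move=> s t _ ->.
- by move=> s t u _ -> _ ->.
- by move=> s s' t t' _ /= -> _ ->.
- by move=> s s' t t' _ /= -> _ ->.
- by move=> s t u /=; rewrite addrA.
- by move=> s t /=; rewrite addrC.
- by move=> s /=; rewrite [ext_scalar n 0]ext_scalar0 add0r.
- by move=> s t u /=; exact: wedgeA.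
- by move=> s /=; exact: wedge1.
- by move=> s /=; apply: (etrans (wedge_scalarl 0 _)); apply/ffunP => K;
    rewrite !ffunE mul0r if_same.
- by move=> s t u /=; exact: wedgeDl.
- by move=> s t u /=; exact: wedgeDr.
- by move=> a b /=; exact/esym/ext_scalarD.
- by move=> a b /=; exact/esym/ext_scalarMM.
- by move=> a s /=; exact: ext_scalar_comm.
- move=> i j /=; have := graded_comm (hw i) (hw j).
  by rewrite -ext_scalar_sign.
Qed.

Lemma aceq_mul0r s : eqac (ACmul s (ACscalar m 0)) (ACscalar m 0).
Proof. by apply: aceq_trans (aceq_mul0 _ s); apply/aceq_sym/aceq_scalarC. Qed.

Lemma aceq_scalarDl a b s :
  eqac (ACadd (ACmul (ACscalar m a) s) (ACmul (ACscalar m b) s)) (ACmul (ACscalar m (a + b)) s).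
Proof.
apply: aceq_trans (aceq_sym (aceq_mulDl _ _ _ _)) _.
by apply: aceq_mul (aceq_scalarD _ _ _) (aceq_refl _ _).
Qed.

Lemma aceq_add0r s : eqac (ACadd s (ACscalar m 0)) s.
Proof. by apply: aceq_trans (aceq_addC _ _ _) (aceq_add0 _ _). Qed.

(** Half of [s] is also its own opposite; replacing one of the two halves of [s] by its opposite
    leaves zero. *)
Lemma aceq_opp_0 s : eqac s (ACmul (ACscalar m (-1)) s) -> eqac s (ACscalar m 0).
Proof.
move=> sN; pose h := ACmul (ACscalar m 2^-1) s.
have hN : eqac h (ACmul (ACscalar m (- 2^-1)) s).
  apply: aceq_trans (aceq_mul (aceq_refl _ _) sN) _.
  apply: aceq_trans (aceq_mulA _ _ _ _) _.
  apply: aceq_mul (aceq_refl _ _).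
  by apply: aceq_trans (aceq_scalarM _ _ _) _; rewrite mulrN1; exact: aceq_refl.
have hh : eqac (ACadd h h) s.
  apply: aceq_trans (aceq_scalarDl _ _ _) _.
  have -> : 2^-1 + 2^-1 = 1 :> R[i] by field.
  exact: aceq_mul1.
apply: aceq_trans (aceq_sym hh) _.
apply: aceq_trans (aceq_add (aceq_refl _ _) hN) _.
apply: aceq_trans (aceq_scalarDl _ _ _) _.
by rewrite subrr; exact: aceq_mul0.
Qed.

Lemma aceq_var_sqr i : odd (deg i) -> eqac (ACmul (ACvar R i) (ACvar R i)) (ACscalar m 0).
Proof.
move=> od; apply: aceq_opp_0; have := aceq_anticomm R deg i i.
by rewrite -signr_odd oddM od.
Qed.

Lemma aceq_odd_pow i k : odd (deg i) -> (1 < k)%N ->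
  eqac (iter k (ACmul (ACvar R i)) (ACscalar m 1)) (ACscalar m 0).
Proof.
move=> od; case: k => [|[|k]] // _ /=.
apply: aceq_trans (aceq_mulA _ _ _ _) _.
apply: aceq_trans (aceq_mul (aceq_var_sqr od) (aceq_refl _ _)) _.
exact: aceq_mul0.
Qed.

End AntiCommutative.

Section TwoVariables.
Local Close Scope classical_set_scope.
Variables (R : realType) (p : nat).
Hypothesis p_gt0 : (0 < p)%N.
Local Notation eqac := (aceq (uv_deg p)).

Lemma acmonomial2 (a : {ffun 'I_2 -> nat}) : acmonomial R a =
  ACmul (iter (a 0) (ACmul (ACvar R 0)) (ACscalar 2 1))
    (ACmul (iter (a 1) (ACmul (ACvar R 1)) (ACscalar 2 1)) (ACscalar 2 1)).
Proof.
rewrite /acmonomial; have -> : enum 'I_2 = [:: 0; 1].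
  by apply: (inj_map val_inj); rewrite val_enum_ord.
by rewrite !big_cons big_nil.
Qed.

Lemma uv_degree (a : 'I_2 -> nat) : (\sum_i a i * uv_deg p i)%N = (a 0%R * p + a 1%R * p.+1)%N.
Proof.
rewrite big_ord_recl big_ord1 /uv_deg !(tnth_nth 0%N) /=.
by congr (_ + a _ * _)%N; exact: val_inj.
Qed.

Lemma acsubst_monomial n (w : 'I_2 -> extalg R n) (a : {ffun 'I_2 -> nat}) :
  acsubst w (acmonomial R a) = w 0 ^+ a 0 * w 1 ^+ a 1.
Proof.
have pw i k : acsubst w (iter k (ACmul (ACvar R i)) (ACscalar 2 1)) = w i ^+ k.
  elim: k => [//|k IH] /=; rewrite IH; exact/esym/exprS.
rewrite acmonomial2 /= !pw; apply: (congr1 (fun x => w 0 ^+ a 0 * x)).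
exact: mulr1.
Qed.

Lemma acmonomial_inadmissible (a : {ffun 'I_2 -> nat}) : ~~ admissible p (a 0) (a 1) ->
  eqac (acmonomial R a) (ACscalar 2 0).
Proof.
rewrite acmonomial2 /admissible; case: ifP => op; rewrite -ltnNge => lt1.
  have z := @aceq_odd_pow R _ (uv_deg p) 0 (a 0) op lt1.
  apply: aceq_trans (aceq_mul z (aceq_refl _ _)) _; exact: aceq_mul0.
have z := @aceq_odd_pow R _ (uv_deg p) 1 (a 1) (negbT op) lt1.
apply: aceq_trans (aceq_mul (aceq_refl _ _) (aceq_mul z (aceq_refl _ _))) _.
apply: aceq_trans (aceq_mul (aceq_refl _ _) (aceq_mul0 _ _)) _; exact: aceq_mul0r.
Qed.

(** If [p] is odd, the degree modulo [p.+1] is -a and determines a in {0, 1}. If [p] is even, hence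
    at least 2, the degree modulo [p] is c and determines c in {0, 1}. *)
Lemma admissible_unique a c a' c' : admissible p a c -> admissible p a' c' ->
  (a * p + c * p.+1 = a' * p + c' * p.+1)%N -> a = a' /\ c = c'.
Proof.
have lemO x y : (p + x * p.+1)%N <> (y * p.+1)%N.
  case: (leqP y x) => yx; have := leq_mul yx (leqnn p.+1); rewrite ?mulSn; lia.
have lemE x y : ~~ odd p -> (x * p + p.+1)%N <> (y * p)%N.
  move=> op; have p1 : (1 < p)%N by case: p p_gt0 op => [|[]].
  case: (leqP y x.+1) => yx; have := leq_mul yx (leqnn p); rewrite ?mulSn; lia.
have inj k x y : (0 < k)%N -> (x * k)%N = (y * k)%N -> x = y.
  by move=> k0 /eqP; rewrite eqn_pmul2r // => /eqP.
rewrite /admissible; case: ifP => op.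
  case: a => [|[|a]] // _; case: a' => [|[|a']] // _; rewrite ?mul0n ?mul1n ?add0n.
  - by move/inj => ->.
  - by move/esym/lemO.
  - by move/lemO.
  - by move/addnI/inj => ->.
case: c => [|[|c]] // _; case: c' => [|[|c']] // _; rewrite ?mul0n ?mul1n ?addn0.
- by move/(inj _ _ _ p_gt0).
- by move/esym/lemE; rewrite op => /(_ isT).
- by move/lemE; rewrite op => /(_ isT).
- by move/addIn/(inj _ _ _ p_gt0).
Qed.

(** Inadmissible monomials are zero and only one admissible monomial has degree [q], so all terms
    collapse onto it. *)
Lemma achomog_admissible q a c s : (a * p + c * p.+1)%N = q -> admissible p a c ->
  achomog (uv_deg p) q s -> exists k, eqac s
    (ACmul (ACscalar 2 k) (acmonomial R [ffun i : 'I_2 => if i == 0 then a else c])).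
Proof.
move=> aq adm [l [lq sl]]; set M := acmonomial R _.
suff [k lk] : exists k, eqac (\big[@ACadd R 2/ACscalar 2 0]_(ca <- l)
    ACmul (ACscalar 2 ca.1) (acmonomial R ca.2)) (ACmul (ACscalar 2 k) M).
  by exists k; exact: aceq_trans sl lk.
elim: l lq {sl} => [|[d x] l IH] lq.
  by exists 0; rewrite big_nil; exact/aceq_sym/aceq_mul0.
have [ca cal|k lk] := IH; first by apply: lq; rewrite inE cal orbT.
have := lq (d, x) (mem_head _ _); rewrite uv_degree /= => xq.
rewrite big_cons /=; have [adx|/acmonomial_inadmissible x0] := boolP (admissible p (x 0) (x 1)).
  have [x0 x1] := admissible_unique adx adm (etrans xq (esym aq)).
  have -> : acmonomial R x = M by rewrite /M !acmonomial2 !ffunE x0 x1.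
  exists (d + k); apply: aceq_trans (aceq_add (aceq_refl _ _) lk) _; exact: aceq_scalarDl.
exists k; apply: aceq_trans (aceq_add (aceq_mul (aceq_refl _ _) x0) lk) _.
apply: aceq_trans (aceq_add (aceq_mul0r _ _) (aceq_refl _ _)) _; exact: aceq_add0.
Qed.

Lemma achomog_zero q s :
  (forall a c, (a * p + c * p.+1)%N = q -> ~~ admissible p a c) ->
  achomog (uv_deg p) q s -> eqac s (ACscalar 2 0 : acpoly R 2).
Proof.
move=> nadm [l [lq sl]]; apply: aceq_trans sl _.
elim: l lq => [|[d x] l IH] lq; first by rewrite big_nil; exact: aceq_refl.
rewrite big_cons /=; have lk : eqac _ _ := IH _.
have {}lk := lk (fun ca cal => lq ca (mem_behead (s := (d, x) :: l) cal)).
have := lq (d, x) (mem_head _ _); rewrite uv_degree /= => /nadm/acmonomial_inadmissible x0.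
apply: aceq_trans (aceq_add (aceq_mul (aceq_refl _ _) x0) lk) _.
apply: aceq_trans (aceq_add (aceq_mul0r _ _) (aceq_refl _ _)) _; exact: aceq_add0.
Qed.

End TwoVariables.

(** * Values of a natural operator *)

Section Classification.
Variables (R : realType) (n : nat) (X : topologicalType).
Variable M : complex_manifold R n X.
Variables (r p q : nat) (P : X -> set (X -> extalg R n) -> extalg R n).
Hypothesis P_natural : natural_operator M r p q P.
Hypothesis p_gt0 : (0 < p)%N.
Local Notation V := 'rV[R[i]]_n.
Local Notation E := (extalg R n).
Local Notation op_at := (op_at M r p P).
Implicit Types (x : X) (w : V -> E) (v : X -> E).

Definition germ_at x v : V -> E := fun z => form_in M (chart_at M x) v (z + centre M x).

Lemma near_germ_at_homog x v : holo_form M p x v ->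
  \forall z \near (0 : V), ext_homog p (germ_at x v z).
Proof.
move=> [hv _]; have := near_bwd (dom_chart_at M x) hv.
rewrite (near_shift 0) subr0; apply: filterS => z; exact: homog_pull.
Qed.

Lemma germ_at0 x v : germ_at x v 0 = v x.
Proof.
rewrite /germ_at add0r /form_in /centre fwdK; last exact: dom_chart_at.
exact: covector_in_chart_at.
Qed.

Lemma ext_d_germ_at x v : ext_d (germ_at x v) 0 = form_d M v x.
Proof.
apply: (etrans (ext_dE _ _)); apply: (etrans _ (esym (ext_dE _ _))).
apply: eq_bigr => k _; apply: (congr1 (fun e : E => _ * e)).
apply/ffunP => I; rewrite [LHS]ffunE [RHS]ffunE.
pose f z := form_in M (chart_at M x) v z I.
have fs := congr1 (fun g : V -> R[i] => g 0) (@pderiv_shift R n k f (- centre M x)).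
have c0 : 0 - - centre M x = centre M x by rewrite sub0r opprK.
apply: (etrans _ (etrans fs (congr1 (pderiv k f) c0))).
apply: (congr1 (fun g : V -> R[i] => pderiv k g 0)); apply/funext => z.
by rewrite /f opprK.
Qed.

Lemma ext_monomial_germ_at a c x v :
  ext_monomial a c (germ_at x v) = v x ^+ a * form_d M v x ^+ c.
Proof. by rewrite /ext_monomial germ_at0 ext_d_germ_at. Qed.

Lemma op_at_jet_form s x w : (r <= s)%N ->
  (\forall z \near (0 : V), ext_homog p (w z)) ->
  op_at x w = op_at x (jet_form 0 (jet_coord s p w)).
Proof.
move=> rs hw; apply: op_at_jet => b br I.
by apply: mpderiv_jet_coord => //; exact: leq_trans br rs.
Qed.

Lemma op_at_translate x x' w : entire_form p w -> op_at x' w = op_at x w.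
Proof.
move=> ew; have := op_at_affine P_natural x x' (unitmx1 _ n) ew.
have -> : (fun z : V => ext_pull (mulmxr 1%:M) (w (z *m 1%:M))) = w.
  apply/funext => z; rewrite mulmx1 -[RHS]ext_pull_id.
  by apply: (congr1 (fun L : V -> V => ext_pull L (w z))); apply/funext => u; exact: mulmx1.
move=> ->; rewrite -[RHS]ext_pull_id.
by apply: (congr1 (fun L : V -> V => ext_pull L (op_at x w))); apply/funext => u; exact: mulmx1.
Qed.

(** Jets of order [r.+1], and not [r], because they always determine [form_d]. *)
Lemma op_at_differentiable_succ x I (a : 'rV[R[i]]_#|{: jet_index n r.+1 p}|) :
  differentiable (fun a : 'rV[R[i]]_#|{: jet_index n r.+1 p}| =>
    op_at x (jet_form 0 a) I) a.
Proof.
have hom (b : 'rV[R[i]]_#|{: jet_index n r.+1 p}|) :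
    \forall z \near (0 : V), ext_homog p (jet_form 0 b z).
  exact: (@filterE _ _ (nbhs_filter _) _ (jet_form_entire b).1).
have -> : (fun a : 'rV[R[i]]_#|{: jet_index n r.+1 p}| => op_at x (jet_form 0 a) I) =
    (fun b => op_at x (@jet_form R n r p 0 b) I) \o
    (fun a : 'rV[R[i]]_#|{: jet_index n r.+1 p}| => jet_coord r p (jet_form 0 a)).
  by apply/funext => b /=; rewrite -op_at_jet_form.
apply: differentiable_comp; last exact: (op_at_differentiable P_natural).
apply: differentiable_row => j.
rewrite (_ : (fun u => _) = (fun u : 'rV[R[i]]_#|{: jet_index n r.+1 p}| =>
  mpderiv (jet_mult (enum_val j)) (fun z => jet_form 0 u z (val (enum_val j)).2) 0)).
  exact: mpderiv_jet_form_differentiable.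
by apply/funext => u; rewrite mxE.
Qed.

(** Used with the opposite of the sought coefficient: the difference of two equivariant
    differentiable operators, to which the vanishing criteria apply. *)
Definition corrected_op a c (k : R[i]) x w : E :=
  op_at x w + ext_scalar n k * ext_monomial a c w.

Lemma corrected_op_equivariant a c k x : equivariant p (corrected_op a c k x).
Proof.
move=> A w uA ew; rewrite /corrected_op ext_pullD ext_pullZ.
by rewrite (op_at_affine P_natural x x uA ew) (@ext_monomial_equivariant R n p a c A w uA ew).
Qed.

Lemma corrected_op_differentiable a c k x I (b : 'rV[R[i]]_#|{: jet_index n r.+1 p}|) :
  differentiable (fun b : 'rV[R[i]]_#|{: jet_index n r.+1 p}| =>
    corrected_op a c k x (jet_form 0 b) I) b.
Proof.
rewrite (_ : (fun u => _) = (fun u : 'rV[R[i]]_#|{: jet_index n r.+1 p}| =>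
  op_at x (jet_form 0 u) I + k * ext_monomial a c (jet_form 0 u) I)).
  apply: differentiableD; first exact: op_at_differentiable_succ.
  apply: differentiableM; first exact: differentiable_cst.
  exact: ext_monomial_differentiable.
by apply/funext => u; rewrite extalgD ext_scalarM.
Qed.

(** [jet_vanish] handles the components of degree [q]. In other degrees both sides have to be zero:
    either the monomial has degree [q], or its coefficient is zero, as happens when no nonzero
    monomial has that degree. *)
Lemma natural_operator_value x0 a c k :
  (forall bs, wf_blocks p bs -> size (block_seq bs) = q ->
     block_val (corrected_op a c (- k) x0) bs = 0) ->
  k = 0 \/ (a * p + c * p.+1)%N = q ->
  forall x v, holo_form M p x v ->
    P x (jet M r p x v) = ext_scalar n k * (v x ^+ a * form_d M v x ^+ c).
Proof.
move=> bs0 kq x v hv; have hg := near_germ_at_homog hv.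
apply: (etrans (op_at_form_in _ _ hv)); rewrite -/(germ_at x v).
(* Both sides depend only on the jet of order [r.+1], so the germ is replaced by its Taylor
   polynomial, an entire form, which can be moved to [x0]. *)
rewrite (op_at_jet_form x (leqnSn r) hg).
set b := jet_coord _ _ _; have eb := jet_form_entire b.
have -> : v x ^+ a * form_d M v x ^+ c = ext_monomial a c (jet_form 0 b).
  rewrite -ext_monomial_germ_at; apply: ext_monomial_jet => d d1 I.
  apply: mpderiv_jet_coord => //; exact: leq_trans d1 _.
rewrite (op_at_translate x0 x eb); apply/ffunP => K; rewrite ext_scalarM.
have [Kq|Kq] := eqVneq #|K| q.
  have := @jet_vanish R n r.+1 p p_gt0 _ (@corrected_op_equivariant a c (- k) x0)
    (@corrected_op_differentiable a c (- k) x0) K _ b.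
  rewrite Kq => /(_ bs0) /eqP; rewrite extalgD ext_scalarM mulNr subr_eq0 => /eqP; exact.
rewrite (op_at_homog P_natural x0 eb Kq).
case: kq => [->|kq]; first by rewrite mul0r.
by rewrite (@ext_monomial_homog R n p a c _ eb) ?mulr0 // kq.
Qed.

End Classification.

(** [aceq (uv_deg p)] is equality in the algebra C{u,v}. *)
Theorem theorem2p8 (R : realType) (n : nat) (X : topologicalType)
    (M : complex_manifold R n X) (X_nonempty : [set: X] !=set0)
    (p r q : nat) (p_gt0 : (0 < p)%N) (q_le_n : (q <= n)%N)
    (P : X -> set (X -> extalg R n) -> extalg R n)
    (P_natural : natural_operator M r p q P) :
  exists s : acpoly R 2,
    [/\ achomog (uv_deg p) q s,
        represents M r p P s
      & forall s' : acpoly R 2,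
          achomog (uv_deg p) q s' -> represents M r p P s' ->
          aceq (uv_deg p) s' s].
Proof.
have [x0 _] := X_nonempty.
have equiv := corrected_op_equivariant P_natural.
have [[a [c [acq adm]]]|nadm] :=
    pselect (exists a c, (a * p + c * p.+1)%N = q /\ admissible p a c); last first.
  exists (ACscalar 2 0); split.
  - by exists [::]; split => //; rewrite big_nil; exact: aceq_refl.
  - move=> x v hv.
    (* The exponents 0 and 0 are placeholders, as the coefficient is zero. *)
    rewrite (@natural_operator_value _ _ _ _ _ _ _ _ P_natural p_gt0 x0 0 0 0 _ _ x v hv).
    + by rewrite ext_scalar0 mul0r; exact/esym/ext_scalar0.
    + move=> bs wbs sbs; apply: (block_val_vanish (equiv _ _ _ _) wbs sbs) => a c bs' acq adm.
      by case: nadm; exists a, c.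
    + by left.
  - move=> s' hs' _; apply: achomog_zero hs' => // a c acq; apply/negP => adm.
    by apply: nadm; exists a, c.
(* Since q <= n, there are [q] distinct coordinates to cut into a standard partition. *)
have sl : size (take q (enum 'I_n)) = (a * p + c * p.+1)%N.
  by rewrite acq size_takel // size_enum_ord.
have [bs0 sh0 e0] := blocks_exist sl.
have u0 : uniq (block_seq bs0) by rewrite e0 take_uniq // enum_uniq.
have wf0 : wf_blocks p bs0.
  rewrite /wf_blocks u0; apply/allP => b bbs.
  have : (size b.1, size b.2) \in block_shape bs0 by apply/mapP; exists b.
  by rewrite sh0 mem_cat !mem_nseq => /orP[] /andP[_ /eqP[_ ->]].
pose Q := @ext_monomial R n a c.
have Q0 : block_val Q bs0 != 0 := block_val_monomial_neq0 R p_gt0 adm sh0 u0.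
(* The choice that makes the corrected operator vanish on [bs0]. *)
pose k := block_val (op_at M r p P x0) bs0 / block_val Q bs0.
have value := @natural_operator_value _ _ _ _ _ _ _ _ P_natural p_gt0 x0 a c k _ (or_intror acq).
have {}value : forall x v, holo_form M p x v ->
    P x (jet M r p x v) = ext_scalar n k * (v x ^+ a * form_d M v x ^+ c).
  apply: value => bs wbs sbs.
  apply: (block_val_vanish (equiv _ _ _ _) wbs sbs) => a' c' bs' acq' adm' w' sh'.
  (* Any standard partition of size [q] has the shape of [bs0], so the vanishing on [bs0] transfers
     to it. *)
  have [ea ec] := admissible_unique p_gt0 adm' adm (etrans acq' (esym acq)).
  rewrite ea ec in sh'; apply: (block_val_shape (equiv _ _ _ _) wf0 w' (etrans sh0 (esym sh'))).
  rewrite /block_val /corrected_op extalgD ext_scalarM -/(block_val _ bs0) -/(block_val Q bs0).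
  by rewrite mulNr /k divfK // subrr.
pose mon := acmonomial R [ffun i : 'I_2 => if i == 0 then a else c].
have subst d x v : acsubst (tnth [tuple v x; form_d M v x]) (ACmul (ACscalar 2 d) mon) =
    ext_scalar n d * (v x ^+ a * form_d M v x ^+ c).
  by rewrite /= acsubst_monomial !ffunE.
exists (ACmul (ACscalar 2 k) mon); split.
- exists [:: (k, [ffun i : 'I_2 => if i == 0 then a else c])]; split.
    by move=> ca; rewrite inE => /eqP ->; rewrite uv_degree !ffunE.
  by rewrite big_cons big_nil; exact/aceq_sym/aceq_add0r.
- by move=> x v hv; rewrite subst value.
move=> s' hs' rs'; have [k' sk'] := achomog_admissible p_gt0 acq adm hs'.
suff -> : k = k' by [].
(* A test form for uniqueness: its germ at [x0] is the block form of [bs0], on which the monomial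
   has a nonzero component, and this determines the coefficient. *)
pose v := form_of M (chart_at M x0) (fun z => block_form bs0 (z - centre M x0)).
have ew : entire_form p (@block_form R n bs0) by have /andP[_] := wf0; exact: block_form_entire.
have hv : holo_form M p x0 v by exact: holo_form_of.
have Qv : v x0 ^+ a * form_d M v x0 ^+ c = Q (block_form bs0).
  rewrite -ext_monomial_germ_at; apply: ext_monomial_jet => b _ I; apply: near_mpderiv.
  have := near_form_in_of M x0 (fun z => block_form bs0 (z - centre M x0)).
  rewrite (near_shift 0) subr0; apply: filterS => z /= e.
  by rewrite /germ_at e addrK.
have homv i : ext_homog (uv_deg p i) (tnth [tuple v x0; form_d M v x0] i).
  have hg := near_germ_at_homog hv.
  have hv0 : ext_homog p (v x0) by rewrite -(germ_at0 M); exact: (nbhs_singleton hg).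
  have hdv : ext_homog p.+1 (form_d M v x0) by rewrite -ext_d_germ_at; exact: ext_d_homog.
  by case: i => [[|[|m]] im]; [exact: hv0|exact: hdv|].
have := rs' x0 v hv; rewrite (acsubst_aceq homv sk') subst (value x0 v hv) Qv.
move=> /ffunP/(_ [set x in block_seq bs0]%SET); rewrite !ext_scalarM => /(mulIf Q0).
exact.
Qed.
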